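(* Let $d\in\mathbb{N}$ and $\lambda>0$. For each $n\in\mathbb{N}$ let $(X^{(n)}_j)_{j\in\mathbb{Z}^d}$ be an associated, weakly stationary random field such that every $X^{(n)}_j$ takes values in $\{0,1\}$. Put $p_n=\mathsf{P}\{X^{(n)}_0=1\}$ and $$\sigma(n)=\sum_{j\in\mathbb{Z}^d,\ j\neq 0}\mathrm{cov}\bigl(X^{(n)}_0,X^{(n)}_j\bigr).$$ Assume that, as $n\to\infty$, $$p_n=\frac{\lambda+o(1)}{n^d}\qquad\text{and}\qquad \lim_{n\to\infty}n^d\sigma(n)=0.$$ For each $n$ define the random measure $\mu_n$ on $\mathbb{R}^d$ by $$\mu_n(A)=\sum_{j\in\mathbb{Z}^d\cap nA}X^{(n)}_j,\qquad nA=\{nx:\ x\in A\},$$ for Borel sets $A\subset\mathbb{R}^d$. Then, as $n\to\infty$, the sequence $\mu_n$ converges in distribution in the vague topology to the Poisson measure $\mu$ on $\mathbb{R}^d$ with parameter $\lambda$.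
   Context: Association: a finite family $(X_1,\ldots,X_m)$ of real random variables is called associated if for every pair of bounded, coordinatewise nondecreasing functions $f,g:\mathbb{R}^m\to\mathbb{R}$ one has $\mathrm{cov}(f(X_1,\ldots,X_m),g(X_1,\ldots,X_m))\ge 0$. An infinite family of random variables is called associated if every finite subfamily is associated. Weak stationarity: a random field $(X_j)_{j\in\mathbb{Z}^d}$ is weakly stationary if it is stationary in the sense of first moment and covariance, i.e. $\mathsf{E}X_j$ does not depend on $j$ and $\mathrm{cov}(X_j,X_k)$ depends only on $k-j$. All terms of the series $\sigma(n)$ are nonnegative by association, so $\sigma(n)\in[0,\infty]$ is well defined. No relation is assumed between the fields for different $n$ (they may be defined on different probability spaces). Vague topology: the topology on the set of locally bounded (i.e. finite on bounded sets) Borel measures on $\mathbb{R}^d$ whose base is the class of finite intersections of sets of the form $\{\nu:\ s<\int_{\mathbb{R}^d}f\,d\nu<t\}$, where $f$ is an arbitrary nonnegative continuous function with bounded support and $s,t\in\mathbb{R}$. Convergence in distribution of random measures is weak convergence of their laws on this topological space. The Poisson measure with parameter $\lambda$ is the Poisson point process (Poisson random measure) on $\mathbb{R}^d$ with intensity measure $\lambda$ times Lebesgue measure. *)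

(* Defs.v *)
From HB Require Import structures.
From mathcomp Require Import all_boot all_order all_algebra finmap zify.
From mathcomp Require Import all_classical all_reals all_analysis.
From mathcomp Require Import measurable_realfun.

Set Implicit Arguments.
Unset Strict Implicit.
Unset Printing Implicit Defensive.

Import Order.TTheory GRing.Theory Num.Theory.
Import numFieldTopology.Exports numFieldNormedType.Exports.

Local Open Scope classical_set_scope.
Local Open Scope ring_scope.

Notation borel E := (g_sigma_algebraType (@open E)).

Section dependence.
Context d (T : measurableType d) (R : realType) (P : probability T R).

Definition nondecreasing_cw m (f : ('I_m -> R) -> R) :=
  forall x y : 'I_m -> R, (forall i, x i <= y i) -> f x <= f y.

(* A coordinatewise nondecreasing function need not be Borel, so the covariance
   is required to be nonnegative exactly when f(X) and g(X) are random
   variables; this is automatic when the X_i take finitely many values. *)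
Definition associated m (X : 'I_m -> T -> R) :=
  forall f g : ('I_m -> R) -> R,
    nondecreasing_cw f -> nondecreasing_cw g ->
    (exists C : R, forall x, `|f x| <= C) ->
    (exists C : R, forall x, `|g x| <= C) ->
    let fX w := f (X ^~ w) in let gX w := g (X ^~ w) in
    measurable_fun setT fX -> measurable_fun setT gX ->
    (0 <= covariance P fX gX)%E.

Definition associated_family I (X : I -> T -> R) :=
  forall m (s : 'I_m -> I), injective s -> associated (fun i => X (s i)).

Definition weakly_stationary (V : zmodType) (X : V -> T -> R) :=
  (forall j k, 'E_P[X j] = 'E_P[X k])%E /\
  (forall j k j' k', k - j = k' - j' ->
    covariance P (X j) (X k) = covariance P (X j') (X k')).

Definition independent d' (E : measurableType d') m (Y : 'I_m -> T -> E) :=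
  forall B : 'I_m -> set E, (forall i, measurable (B i)) ->
    P (\bigcap_i (Y i @^-1` B i)) = (\prod_i P (Y i @^-1` B i))%E.

End dependence.

Section locally_finite_measures.
Context (R : realType) (d : nat).

Record lfmeasure := LFMeasure {
  lfm :> {measure set (borel 'rV[R]_d) -> \bar R} ;
  lfmP : forall A : set 'rV[R]_d, measurable (A : set (borel 'rV[R]_d)) ->
    bounded_set A -> (lfm A < +oo)%E }.

Definition lfmeasure0 : lfmeasure.
Proof. by exists mzero => A _ _; exact: ltry. Defined.

HB.instance Definition _ := gen_eqMixin lfmeasure.
HB.instance Definition _ := gen_choiceMixin lfmeasure.
HB.instance Definition _ := isPointed.Build lfmeasure lfmeasure0.

Definition vague_test : set ('rV[R]_d -> R) :=
  [set f : 'rV[R]_d -> R | [/\ continuous f, (forall x, 0 <= f x)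
    & bounded_set [set x | f x != 0]]].

(* Elements of lfmeasure that agree on Borel sets but differ as functions on
   arbitrary sets are topologically indistinguishable. *)
HB.instance Definition _ := @isSubBaseTopological.Build lfmeasure
  (('rV[R]_d -> R) * (R * R))%type
  [set i | vague_test i.1]
  (fun i => [set nu : lfmeasure |
     (i.2.1%:E < \int[nu]_x (i.1 x)%:E < i.2.2%:E)%E]).

End locally_finite_measures.

Section lattice_measure.
Context (R : realType) (d n : nat).

(* Z^d \cap (n + 1)A: the scale is n + 1, so that sequences indexed from 0
   stand for sequences indexed by the positive integers. *)
Definition lattice_points (A : set 'rV[R]_d) : set 'rV[int]_d :=
  [set j | exists2 x, A x & map_mx intr j = n.+1%:R *: x].

Lemma lattice_pointsE A j :
  lattice_points A j <-> A (n.+1%:R^-1 *: map_mx intr j).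
Proof.
split=> [[x Ax ->]|Aj]; first by rewrite scalerA mulVf ?pnatr_eq0// scale1r.
by exists (n.+1%:R^-1 *: map_mx intr j) => //;
  rewrite scalerA mulfV ?pnatr_eq0// scale1r.
Qed.

Lemma finite_lattice_points A : bounded_set A -> finite_set (lattice_points A).
Proof.
move=> [M0 [_ /(_ (M0 + 1))]]; rewrite ltrDl ltr01 => /(_ isT).
set M := M0 + 1 => AM.
pose K := (Num.bound (n.+1%:R * `|M|)).
pose g (h : {ffun 'I_d -> 'I_(K + K).+1}) : 'rV[int]_d :=
  \row_i ((h i : nat)%:Z - K%:Z).
apply: (@sub_finite_set _ _ (range g)); last first.
  by apply: finite_image; exact: finite_finset.
move=> j /lattice_pointsE /AM jM.
have jK i : (`|j ord0 i|%N <= K)%N.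
  rewrite -(ler_nat R) natr_absz intr_norm.
  have : `|(n.+1%:R^-1 *: map_mx intr j) ord0 i| <= `|M|.
    apply: le_trans (ler_norm M); apply: le_trans jM.
    rewrite [leRHS]/Num.norm/= mx_normrE.
    by apply/bigmax_geP; right => /=; exists (ord0, i).
  rewrite !mxE normrM gtr0_norm ?invr_gt0 ?ltr0n//.
  rewrite -ler_pdivlMl ?invr_gt0 ?ltr0n// invrK => /le_trans; apply.
  by apply/ltW/archi_boundP; rewrite mulr_ge0.
exists [ffun i => inord (absz (j ord0 i + K%:Z))] => //.
apply/rowP => i; rewrite !mxE ffunE (ord1 0).
move: (jK i); move: (j ord0 i) (K) => z k zk.
by rewrite inordK; lia.
Qed.

Context (x : 'rV[int]_d -> R).

Definition lattice_measure of (forall j, 0 <= x j) :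
    set (borel 'rV[R]_d) -> \bar R :=
  fun A => (\esum_(j in lattice_points A) (x j)%:E)%E.

Context (x0 : forall j, 0 <= x j).
Local Notation mu := (lattice_measure x0).

Let mu0 : mu set0 = 0%E.
Proof.
rewrite /mu (_ : lattice_points set0 = set0) ?esum_set0//.
by rewrite -subset0 => j /lattice_pointsE.
Qed.

Let mu_ge0 A : (0 <= mu A)%E.
Proof. by apply: esum_ge0 => j _; rewrite lee_fin. Qed.

Let mu_sigma_additive : semi_sigma_additive mu.
Proof.
move=> F mF tF mUF.
have -> : mu (\bigcup_i F i) = (\sum_(0 <= i <oo) mu (F i))%E.
  rewrite -nneseries_sum_bigcup; last 2 first.
  - move=> i k _ _ [j [/lattice_pointsE Fi /lattice_pointsE Fk]].
    by apply: tF => //; exists (n.+1%:R^-1 *: map_mx intr j).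
  - by move=> j; rewrite lee_fin.
  congr esum; apply/seteqP; split => j.
    by move=> /lattice_pointsE[i _ Fi]; exists i => //; exact/lattice_pointsE.
  by move=> [i _ /lattice_pointsE Fi]; apply/lattice_pointsE; exists i.
exact: is_cvg_nneseries.
Qed.

HB.instance Definition _ := isMeasure.Build _ _ _ mu
  mu0 mu_ge0 mu_sigma_additive.

Lemma lattice_measure_locally_finite (A : set 'rV[R]_d) :
  measurable (A : set (borel 'rV[R]_d)) -> bounded_set A -> (mu A < +oo)%E.
Proof.
move=> _ /finite_lattice_points fA; rewrite /mu esum_fset//.
  by rewrite fsbig_finite//= sumEFin ltry.
by move=> j _; rewrite lee_fin.
Qed.

Definition lattice_lfmeasure : lfmeasure R d :=
  LFMeasure lattice_measure_locally_finite.

End lattice_measure.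

Lemma lattice_integral_local (R : realType) (d n : nat) (f : 'rV[R]_d -> R) :
  vague_test f -> exists J : {fset 'rV[int]_d},
  forall x y (x0 : forall j, 0 <= x j) (y0 : forall j, 0 <= y j),
    (forall j, j \in J -> x j = y j) ->
  (\int[lattice_measure n x0]_z (f z)%:E =
   \int[lattice_measure n y0]_z (f z)%:E)%E.
Proof.
move=> [_ _ /(@finite_lattice_points _ _ n) fJ].
exists (fset_set (lattice_points n [set x | f x != 0])) => x y x0 y0 xy.
have fE : EFin \o f = (EFin \o f) \_ [set x | f x != 0].
  apply/funext => z; rewrite patchE; case: ifPn => //.
  by rewrite notin_setE /= => /negP; rewrite negbK => /eqP ->.
rewrite -[fun z => _]/(EFin \o f) fE -!integral_mkcond.
apply: eq_measure_integral => A _ AD; apply: eq_esum => j /lattice_pointsE Aj.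
by rewrite xy// in_fset_set// inE; apply/lattice_pointsE/AD.
Qed.

Lemma lattice_lfmeasure_open (R : realType) (d n : nat)
    (U : set (lfmeasure R d)) x (x0 : forall j, 0 <= x j) :
  open U -> U (lattice_lfmeasure n x0) -> exists J : {fset 'rV[int]_d},
  forall y (y0 : forall j, 0 <= y j), (forall j, j \in J -> x j = y j) ->
  U (lattice_lfmeasure n y0).
Proof.
move=> [/= D' D'sub <-] [B D'B Bx].
have [F Fsub FB] := D'sub _ D'B.
have loc (i : ('rV[R]_d -> R) * (R * R)) : exists J : {fset 'rV[int]_d},
    vague_test i.1 ->
    forall y (y0 : forall j, 0 <= y j), (forall j, j \in J -> x j = y j) ->
    (\int[lattice_measure n x0]_z (i.1 z)%:E =
     \int[lattice_measure n y0]_z (i.1 z)%:E)%E.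
  have [/lattice_integral_local-/(_ n)[J JP]|ni] := pselect (vague_test i.1).
    by exists J => _ y y0; exact: JP.
  by exists fset0.
have /choice[J JP] := loc.
exists (\bigcup_(i <- F) J i)%fset => y y0 xy.
exists B => //; move: Bx; rewrite -FB => Bx i Fi; have /= := Bx i Fi.
have -> := JP i _ _ y0 => //.
  by have := Fsub _ Fi; rewrite inE.
by move=> j Jj; apply: xy; apply/bigfcupP; exists i => //; rewrite andbT.
Qed.

Section scaled_measure.
Context dT (T : measurableType dT) (R : realType) (P : probability T R).
Context (d n : nat) (X : 'rV[int]_d -> {RV P >-> R}).
Context (X01 : forall j w, X j w = 0 \/ X j w = 1).

Let X_ge0 w j : 0 <= X j w.
Proof. by have [->|->] := X01 j w. Qed.

(* A |-> \sum_(j in Z^d \cap (n + 1)A) X_j, as a random element of the space of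
   locally finite measures with its vague Borel sigma-algebra. *)
Definition scaled_measure w : borel (lfmeasure R d) :=
  lattice_lfmeasure n (X_ge0 w).

Lemma measurable_scaled_measure : measurable_fun setT scaled_measure.
Proof.
have := @measurability _ _ T (borel (lfmeasure R d)) setT scaled_measure (@open (lfmeasure R d)).
move=> /(_ erefl); apply => _ [U oU <-].
rewrite setTI.
pose cyl (p : {fset 'rV[int]_d} * {fset 'rV[int]_d}) :=
  \bigcap_(j in [set` p.1]) (X j @^-1` [set (j \in p.2)%:R]).
rewrite (_ : _ @^-1` _ =
    \bigcup_p (if `[< cyl p `<=` scaled_measure @^-1` U >] then cyl p else set0)).
  apply: countable_bigcupT_measurable; first exact: countableP.
  move=> p; case: ifPn => // _; exact: fin_bigcap_measurable.
apply/seteqP; split => [w /= Uw|w [p _]]; last first.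
  by case: ifPn => // /asboolP; apply.
have [J JP] := lattice_lfmeasure_open oU Uw.
exists (J, [fset j in J | X j w == 1]%fset) => //.
have cylP w' : cyl (J, [fset j in J | X j w == 1]%fset) w' <->
    forall j, j \in J -> X j w = X j w'.
  have XE j : j \in J ->
      (j \in [fset j in J | X j w == 1]%fset)%:R = X j w :> R.
    by rewrite !inE => ->/=; have [->|->] := X01 j w; rewrite ?eqxx// eq_sym oner_eq0.
  by split => [H j Jj|H j Jj]; have /= := H j Jj; rewrite XE.
case: ifPn => [_|/asboolP]; first exact/cylP.
by case=> w' /cylP; exact: JP.
Qed.

HB.instance Definition _ :=
  isMeasurableFun.Build _ _ _ _ scaled_measure measurable_scaled_measure.

End scaled_measure.

Section poisson_random_measure.
Context (R : realType).
Local Open Scope ereal_scope.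

(* Cavalieri: L_0 is the unit mass at the point of R^0, and
   L_(d+1)(A) = \int L_d(A_t) dt where A_t = {v | (t, v) \in A}. *)
Fixpoint lebesgue_rV d : set 'rV[R]_d -> \bar R :=
  match d with
  | 0 => fun A => (\1_A 0%R)%:E
  | d'.+1 => fun A => \int[lebesgue_measure]_t
      lebesgue_rV [set v : 'rV[R]_d' | A (row_mx (t%:M : 'rV[R]_1) v)]
  end.

Lemma lebesgue_rV_set0 d : lebesgue_rV (set0 : set 'rV[R]_d) = 0.
Proof.
by elim: d => [|d IH] /=; [rewrite indic0|exact: integral0_eq].
Qed.

Lemma lebesgue_rV_box d (a b : 'I_d -> R) : (forall i, (a i <= b i)%R) ->
  lebesgue_rV [set x | forall i, x ord0 i \in `]a i, b i]%R] =
  (\prod_(i < d) (b i - a i))%:E.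
Proof.
elim: d a b => [|d IH] a b ab /=.
  by rewrite big_ord0 indicE mem_set// => -[].
have row0 t (v : 'rV[R]_d) :
    (row_mx (t%:M : 'rV[R]_1) v : 'rV[R]_d.+1) ord0 ord0 = t.
  transitivity (row_mx (t%:M : 'rV[R]_1) v ord0 (lshift d ord0)).
    by congr (row_mx _ _ _ _); exact: val_inj.
  by rewrite row_mxEl mxE mulr1n.
have rowS t (v : 'rV[R]_d) i :
    (row_mx (t%:M : 'rV[R]_1) v : 'rV[R]_d.+1) ord0 (lift ord0 i) = v ord0 i.
  by rewrite -rshift1; exact: row_mxEr.
transitivity (\int[lebesgue_measure]_(t in `]a ord0, b ord0]%classic)
    (\prod_(i < d) (b (lift ord0 i) - a (lift ord0 i)))%:E).
  rewrite [RHS]integral_mkcond; apply: eq_integral => t _.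
  rewrite patchE; case: ifPn => [/set_mem/= tab|].
    rewrite -IH//; congr lebesgue_rV; apply/seteqP; split => v /= vab i.
      by have := vab (lift ord0 i); rewrite rowS.
    by have [j ->|->] := unliftP ord0 i; rewrite ?rowS ?row0.
  rewrite notin_setE /= => tab.
  rewrite -[RHS](lebesgue_rV_set0 d); congr lebesgue_rV.
  by apply/seteqP; split => v //= /(_ ord0); rewrite row0.
rewrite integral_cst//= lebesgue_measure_itv/= lte_fin big_ord_recl.
rewrite EFinM muleC; case: ifPn => //; rewrite -leNgt => ba.
have -> : a ord0 = b ord0 by apply/eqP; rewrite eq_le ab ba.
by rewrite subrr.
Qed.

(* Stated for an arbitrary set function Lambda; only its values on Borel sets
   matter. *)
Definition poisson_random_measure dO (O : measurableType dO)
    (Q : probability O R) d (Lambda : set 'rV[R]_d -> \bar R)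
    (N : O -> lfmeasure R d) :=
  (forall A : set (borel 'rV[R]_d), measurable A -> Lambda A < +oo ->
    let l := fine (Lambda A) in
    forall k : nat,
      Q [set w | N w A = k%:R%:E] = (l ^+ k / k`!%:R * expR (- l))%:E) /\
  (forall m (A : 'I_m -> set (borel 'rV[R]_d)), (forall i, measurable (A i)) ->
    trivIset setT A -> independent Q (fun i w => N w (A i))).

Definition weak_cvg (E : ptopologicalType) (L : nat -> probability (borel E) R)
    (l : probability (borel E) R) :=
  forall f : E -> R, continuous f -> (exists C : R, forall x, (`|f x| <= C)%R) ->
    (fun n => \int[L n]_x (f x)%:E) @ \oo --> \int[l]_x (f x)%:E.

End poisson_random_measure.

(* Main.v *)
Require Import Defs.
From HB Require Import structures.
From mathcomp Require Import all_boot all_order all_algebra finmap zify ring lra.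
From mathcomp Require Import all_classical all_reals all_analysis.
From mathcomp Require Import measurable_realfun.

Set Implicit Arguments.
Unset Strict Implicit.
Unset Printing Implicit Defensive.

Import Order.TTheory GRing.Theory Num.Theory.
Import numFieldTopology.Exports numFieldNormedType.Exports.

Local Open Scope classical_set_scope.
Local Open Scope ring_scope.

(**
Two facts carry the proof: a vaguely continuous function is almost determined,
near each measure, by the masses of the cells of a fine enough grid of cubes,
and the joint law of the cell counts converges to a product of Poisson laws.

Grid. For each m let the cube ]-(m+1), m+1]^d be cut into half-open cells of
side 1/(m+1). If F is vaguely continuous and nu is a locally finite measure,
then for m large F is at least F(nu) - e on all measures that give every cell
of level m the same mass as nu ([vague_continuous_same_cells]): a test function
oscillates little on each cell, so its integral is almost determined by the
masses of the cells. For F >= 0 bounded, the infimum of F over the measures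
with the same cell masses is hence a lower bound of F that tends to F as m
grows. On measures with natural cell masses it takes countably many values
only, so its expectation is controlled by the probabilities of the
events that all cells have prescribed counts. Convergence of these
probabilities therefore gives liminf E F(mu_n) >= E F(mu), and applying this to
F + C and to C - F gives weak convergence ([weak_cvg_of_cell_counts]).

Counts. Let g be a function of 0/1 variables X_i, i in s, with values in {0,1}.
Changing one coordinate from 0 to 1 changes g by at most 1, so both
sum_i X_i + g and sum_i X_i - g are nondecreasing; association then gives
|cov(g, X_j)| <= sum_i cov(X_i, X_j) ([associated_cov_le]), and the right-hand
side is at most sigma(n) by stationarity. Hence revealing the sites one after
another and replacing each X_j by an independent Bernoulli variable costs at
most 2 sigma(n) per site: the joint law of the counts in disjoint blocks is a
product of binomial laws up to 2 sigma(n) times the number of sites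
([counts_are_approx]). For the cells of a fixed grid that number is of order
n^d, so the error vanishes by the assumption n^d sigma(n) -> 0, while the
binomial laws converge to Poisson laws because n^d p_n -> lambda
([cvg_cell_counts]). The cell counts of the Poisson measure have exactly the
limiting law, and they are almost surely natural numbers.
*)

(** * Associated 0/1 variables: block counts are nearly binomial *)

Section bounded_variables.
Context d (T : measurableType d) (R : realType) (P : probability T R).
Implicit Types G H : T -> R.

Definition bounded_rv G :=
  measurable_fun setT G /\ exists C : R, forall w, `|G w| <= C.

(** Real-valued counterparts of expectation and covariance, so that bounded
    variables can be handled by ring arithmetic. *)
Definition mean G : R := \int[P]_w G w.
Definition rcov G H := mean (G \* H) - mean G * mean H.

Lemma bounded_rvD G H : bounded_rv G -> bounded_rv H -> bounded_rv (G \+ H).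
Proof.
move=> [mG [C GC]] [mH [D HD]]; split; first exact: measurable_funD.
by exists (C + D) => w; apply: le_trans (ler_normD _ _) (lerD _ _).
Qed.

Lemma bounded_rvM G H : bounded_rv G -> bounded_rv H -> bounded_rv (G \* H).
Proof.
move=> [mG [C GC]] [mH [D HD]]; split; first exact: measurable_funM.
by exists (C * D) => w; rewrite normrM ler_pM.
Qed.

Lemma bounded_rv_cst c : bounded_rv (cst c).
Proof. by split => //; exists `|c|. Qed.

Lemma bounded_rvZ c G : bounded_rv G -> bounded_rv (fun w => c * G w).
Proof. exact: bounded_rvM (bounded_rv_cst c). Qed.

Lemma bounded_rv_sum I (s : seq I) (G : I -> T -> R) :
  (forall i, bounded_rv (G i)) -> bounded_rv (fun w => \sum_(i <- s) G i w).
Proof.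
move=> bG; elim: s => [|i s IH].
  by under eq_fun do rewrite big_nil; exact: bounded_rv_cst.
by under eq_fun do rewrite big_cons; exact: bounded_rvD.
Qed.

Lemma bounded_rv_bool (b : T -> bool) :
  measurable_fun setT b -> bounded_rv (fun w => (b w)%:R).
Proof.
move=> mb; split; last by exists 1 => w; case: (b w); rewrite ?normr1 ?normr0.
rewrite (_ : (fun w => _) = fun w => if b w then 1 else 0).
  exact: measurable_fun_ifT.
by apply/funext => w; case: (b w).
Qed.

Lemma bounded_rv_integrable G :
  bounded_rv G -> P.-integrable setT (EFin \o G).
Proof.
move=> [mG [C GC]]; apply: measurable_bounded_integrable => //.
  by rewrite [ltLHS]probability_setT ltry.
exists C; split; first exact: num_real.
by move=> x Cx w _; exact: le_trans (GC w) (ltW Cx).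
Qed.

Lemma meanD G H : bounded_rv G -> bounded_rv H ->
  mean (G \+ H) = mean G + mean H.
Proof. by move=> bG bH; rewrite /mean RintegralD//; exact: bounded_rv_integrable. Qed.

Lemma meanZ c G : bounded_rv G -> mean (fun w => c * G w) = c * mean G.
Proof. by move=> bG; rewrite /mean RintegralZl//; exact: bounded_rv_integrable. Qed.

Lemma mean_cst c : mean (cst c) = c.
Proof. by rewrite /mean Rintegral_cst// [X in fine X]probability_setT mulr1. Qed.

Lemma mean_le G H : bounded_rv G -> bounded_rv H ->
  (forall w, G w <= H w) -> mean G <= mean H.
Proof.
by move=> bG bH GH; apply: le_Rintegral => //; exact: bounded_rv_integrable.
Qed.

Lemma expectation_mean G : bounded_rv G -> 'E_P[G]%E = (mean G)%:E.
Proof.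
move=> bG; rewrite unlock /mean /Rintegral fineK//.
by apply: integrable_fin_num => //; exact: bounded_rv_integrable.
Qed.

Lemma covariance_rcov G H : bounded_rv G -> bounded_rv H ->
  covariance P G H = (rcov G H)%:E.
Proof.
move=> bG bH.
rewrite covarianceE; last 3 first.
- exact/Lfun1_integrable/bounded_rv_integrable.
- exact/Lfun1_integrable/bounded_rv_integrable.
- exact/Lfun1_integrable/bounded_rv_integrable/bounded_rvM.
rewrite (expectation_mean (bounded_rvM bG bH)).
by rewrite !expectation_mean.
Qed.

Lemma rcovDl G G' H : bounded_rv G -> bounded_rv G' -> bounded_rv H ->
  rcov (G \+ G') H = rcov G H + rcov G' H.
Proof.
move=> bG bG' bH; rewrite /rcov meanD//.
have -> : (G \+ G') \* H = (G \* H) \+ (G' \* H).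
  by apply/funext => w /=; rewrite mulrDl.
by rewrite meanD; [ring|exact: bounded_rvM|exact: bounded_rvM].
Qed.

Lemma rcovZl c G H : bounded_rv G -> bounded_rv H ->
  rcov (fun w => c * G w) H = c * rcov G H.
Proof.
move=> bG bH; rewrite /rcov meanZ//.
have -> : (fun w => c * G w) \* H = (fun w => c * (G w * H w)).
  by apply/funext => w /=; rewrite mulrA.
by rewrite (meanZ _ (bounded_rvM bG bH)); ring.
Qed.

Lemma rcov_suml I (s : seq I) (G : I -> T -> R) H :
    (forall i, bounded_rv (G i)) -> bounded_rv H ->
  rcov (fun w => \sum_(i <- s) G i w) H = \sum_(i <- s) rcov (G i) H.
Proof.
move=> bG bH; elim: s => [|i s IH].
  rewrite big_nil; under [X in rcov X _]eq_fun do rewrite big_nil.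
  rewrite /rcov (mean_cst 0) (_ : _ \* _ = cst 0) ?mean_cst ?mul0r ?subrr//.
  by apply/funext => w /=; rewrite mul0r.
rewrite big_cons -IH; under [X in rcov X _]eq_fun do rewrite big_cons.
by apply: rcovDl => //; exact: bounded_rv_sum.
Qed.

End bounded_variables.

Definition binomial_weight (R : realType) (p : R) (N k : nat) : R :=
  'C(N, k)%:R * p ^+ k * (1 - p) ^+ (N - k).

Lemma binomial_weight0 (R : realType) (p : R) N :
  binomial_weight p N.+1 0 = (1 - p) * binomial_weight p N 0.
Proof. by rewrite /binomial_weight !bin0 !subn0 exprS; ring. Qed.

(** Pascal's rule conditioned on the last trial; together with the case k = 0
    it is the recursion satisfied, up to covariances, by the block counts. *)
Lemma binomial_weightS (R : realType) (p : R) N k :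
  binomial_weight p N.+1 k.+1 =
  (1 - p) * binomial_weight p N k.+1 + p * binomial_weight p N k.
Proof.
rewrite /binomial_weight binS natrD subSS.
have [kN|Nk] := ltnP k N.
  rewrite (_ : (N - k)%N = (N - k.+1).+1); last by lia.
  by rewrite !exprS; ring.
by rewrite (@bin_small N k.+1)// !exprS; ring.
Qed.

(** Sites are listed together with the block they belong to; q.1 is the block
    and q.2 the site. *)
Section block_counts.
Context (I : choiceType) (B : finType).
Implicit Types (s : seq (B * I)) (k : B -> nat) (x : I -> bool).

Definition block_count s x b := count (fun q => (q.1 == b) && x q.2) s.

Definition counts_are s k x := [forall b, block_count s x b == k b].

Lemma block_count_eq s x y b : {in unzip2 s, x =1 y} ->
  block_count s x b = block_count s y b.
Proof.
move=> xy; apply: eq_in_count => q qs; congr andb; apply: xy.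
exact: map_f.
Qed.

Lemma counts_are_eq s k x y : {in unzip2 s, x =1 y} ->
  counts_are s k x = counts_are s k y.
Proof.
by move=> xy; apply: eq_forallb => b; rewrite (block_count_eq b xy).
Qed.

(** An occupied site must be subtracted from the target of its block; the
    condition 0 < k q.1 guards the truncated subtraction. *)
Lemma counts_are_cons q s k x : counts_are (q :: s) k x =
  if x q.2 then (0 < k q.1)%N && counts_are s (fun b => k b - (q.1 == b))%N x
  else counts_are s k x.
Proof.
rewrite /counts_are /block_count/=; case: ifPn => xq; last first.
  by apply: eq_forallb => b; rewrite andbF add0n.
apply/forallP/andP => [H|[k0 /forallP H] b].
  have := H q.1; rewrite eqxx => /eqP <-; split => //.
  by apply/forallP => b; rewrite -(eqP (H b)) andbT addKn.
rewrite (eqP (H b)) andbT; have [<-|_] := eqVneq q.1 b; last by rewrite subn0.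
by rewrite subnKC.
Qed.

End block_counts.

Section associated_counts.
Context d (T : measurableType d) (R : realType) (P : probability T R).
Context (I : choiceType) (X : I -> {RV P >-> R}).
Hypothesis X01 : forall j w, X j w = 0 \/ X j w = 1.
Hypothesis X_assoc : associated_family P X.

Local Notation E := (mean P).
Local Notation cov := (rcov P).

Definition ones w i := X i w == 1.

Lemma onesE w i : X i w = (ones w i)%:R.
Proof. by rewrite /ones; have [->|->] := X01 i w; rewrite ?eqxx// eq_sym oner_eq0. Qed.

Lemma bounded_rv01 i : bounded_rv (X i).
Proof.
split => //; exists 1 => w.
by have [->|->] := X01 i w; rewrite ?normr0 ?normr1.
Qed.

Lemma measurable_ones i : measurable_fun setT (ones ^~ i).
Proof. by apply: measurable_fun_eqr. Qed.

(** The covariance inequality for associated 0/1 variables: as g is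
    1-Lipschitz for the number of changed coordinates, sum_i X_i + g and
    sum_i X_i - g are nondecreasing functions, hence positively correlated
    with X_j. *)
Lemma associated_cov_le (j : I) (s : seq I) (g : (I -> bool) -> bool) :
  uniq (j :: s) -> (forall x y, {in s, x =1 y} -> g x = g y) ->
  measurable_fun setT (fun w => g (ones w)) ->
  `|cov (fun w => (g (ones w))%:R) (X j)| <= \sum_(i <- s) cov (X i) (X j).
Proof.
move=> js gs mg.
pose m := (size s).+1.
pose site (i : 'I_m) := nth j (j :: s) i.
have site_inj : injective site.
  move=> i i' /eqP; rewrite nth_uniq//= ?ltn_ord//.
  by move=> /eqP; exact: val_inj.
(* Association speaks of functions on R^m: a real coordinate is read as a
   bit by comparing it with 1. *)
pose one (y : 'I_m -> R) i := 1 <= y (inord (index i (j :: s))).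
have oneP w i : i \in j :: s -> one (fun l => X (site l) w) i = ones w i.
  move=> ijs; rewrite /one /site inordK; last by rewrite ltnS -index_mem in ijs *.
  rewrite nth_index// onesE; case: (ones w i); first exact: lexx.
  by rewrite leNgt ltr01.
have b2r_le (b c : bool) : (b -> c) -> b%:R <= c%:R :> R.
  by case: b; case: c => // /(_ isT).
have one_mono (y y' : 'I_m -> R) i : (forall l, y l <= y' l) -> one y i -> one y' i.
  by move=> yy' /le_trans; apply.
have bG : bounded_rv (fun w => (g (ones w))%:R : R) by exact: bounded_rv_bool.
(* The sign e treats both nondecreasing functions at once. *)
suff H (e : R) : e = 1 \/ e = -1 ->
    0 <= \sum_(i <- s) cov (X i) (X j) + e * cov (fun w => (g (ones w))%:R) (X j).
  have := H 1 (or_introl erefl); have := H (-1) (or_intror erefl).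
  by rewrite ler_norml; lra.
move=> e1.
rewrite -rcovZl//; last exact: bounded_rv01.
rewrite -rcov_suml; [|exact: bounded_rv01|exact: bounded_rv01].
rewrite -rcovDl; [|by apply: bounded_rv_sum => i; exact: bounded_rv01
  |exact: bounded_rvZ|exact: bounded_rv01].
set F := (X in cov X _).
have bF : bounded_rv F.
  apply: bounded_rvD; last exact: bounded_rvZ.
  by apply: bounded_rv_sum => i; exact: bounded_rv01.
rewrite -lee_fin -covariance_rcov//; last exact: bounded_rv01.
pose f y := \sum_(i <- s) (one y i)%:R + e * (g (one y))%:R : R.
pose h y := (one y j)%:R : R.
have fE w : f (fun l => X (site l) w) = F w.
  rewrite /f /F/=; congr (_ + e * (nat_of_bool _)%:R); last first.
    by apply: gs => i is_; rewrite oneP// inE is_ orbT.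
  by apply: eq_big_seq => i is_; rewrite oneP ?onesE// inE is_ orbT.
have hE w : h (fun l => X (site l) w) = X j w.
  by rewrite /h oneP ?onesE// mem_head.
have := @X_assoc m site site_inj f h.
rewrite (_ : (fun w => f _) = F); last by apply/funext => w; exact: fE.
rewrite (_ : (fun w => h _) = X j); last by apply/funext => w; exact: hE.
apply; last 3 first.
- exists 1 => y; rewrite /h; case: (one y j); rewrite ?normr0 ?normr1//.
- by case: bF.
- by [].
- move=> y y' yy'; rewrite /f.
  have [same|] := boolP (all (fun i => one y i == one y' i) s).
    rewrite (gs _ (one y')); last by move=> i is_; exact/eqP/(allP same).
    by rewrite lerD2r; apply: ler_sum => i _; apply: b2r_le; exact: one_mono.
  case/allPn => i is_ /negP ne.
  have /andP[yi y'i] : ~~ one y i && one y' i.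
    have := @one_mono y y' i yy'; move: ne.
    by case: (one y i); case: (one y' i) => //= _ /(_ isT).
  have le_sum : \sum_(i <- s) (one y i)%:R + 1 <= \sum_(i <- s) (one y' i)%:R :> R.
    rewrite (big_rem i)//= [leRHS](big_rem i)//= (negbTE yi) y'i add0r addrC; apply: lerD => //.
    by apply: ler_sum => l _; apply: b2r_le; exact: one_mono.
  have : e * (g (one y))%:R <= 1 + e * (g (one y'))%:R.
    by case: e1 => ->; case: (g _); case: (g _); rewrite /=; lra.
  by move: le_sum; lra.
- by move=> y y' yy'; apply: b2r_le; exact: one_mono.
- exists (\sum_(i <- s) 1 + `|e|) => y; rewrite /f.
  apply: le_trans (ler_normD _ _) (lerD _ _).
    apply: le_trans (ler_norm_sum _ _ _) (ler_sum _ _) => i _.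
    by case: (one y i); rewrite ?normr1 ?normr0.
  by rewrite normrM; case: (g _); rewrite /= ?normr1 ?normr0 ?mulr1 ?mulr0.
Qed.

Context (B : finType) (p sigma : R).
Hypothesis p01 : 0 <= p <= 1.
Hypothesis meanX : forall i, E (X i) = p.
Hypothesis cov_sum : forall (j : I) (s : seq I), uniq (j :: s) ->
  \sum_(i <- s) cov (X i) (X j) <= sigma.

Lemma measurable_counts_are (s : seq (B * I)) (k : B -> nat) :
  measurable_fun setT (fun w => counts_are s k (ones w)).
Proof.
elim: s k => [|q s IH] k; first exact: (measurable_cst [forall b, 0 == k b]%N).
under eq_fun do rewrite counts_are_cons.
apply: measurable_fun_ifT => //; first exact: measurable_ones.
exact: measurable_and.
Qed.

(** Induction on the sites: conditionally on X_j the event about j :: s is an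
    event about s, so its probability satisfies the binomial recursion up to
    two covariances with X_j, each at most sigma. *)
Lemma counts_are_approx (s : seq (B * I)) (k : B -> nat) : uniq (unzip2 s) ->
  `|E (fun w => (counts_are s k (ones w))%:R) -
    \prod_b binomial_weight p (count (fun q => q.1 == b) s) (k b)| <=
  2 * sigma *+ size s.
Proof.
elim: s k => [|[b j] s IH] k /= us.
  rewrite mulr0n normr_le0 subr_eq0; apply/eqP.
  have [k0|/existsP[b kb]] := boolP [forall b, k b == 0%N].
    rewrite (_ : (fun w => _) = cst 1).
      rewrite mean_cst big1// => b _; rewrite (eqP (forallP k0 b)).
      by rewrite /binomial_weight bin0 subn0 !expr0 !mulr1.
    apply/funext => w; rewrite (_ : counts_are _ _ _)//.
    by apply/forallP => b; rewrite eq_sym; exact: (forallP k0).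
  rewrite (bigD1 b)//= {1}/binomial_weight bin0n (negbTE kb) !mul0r.
  rewrite (_ : (fun w => _) = cst 0) ?mean_cst//.
  apply/funext => w; rewrite (_ : counts_are _ _ _ = false)//.
  by apply/negP => /forallP/(_ b); rewrite eq_sym; exact/negP.
have us' : uniq (j :: unzip2 s) by [].
have {us} us : uniq (unzip2 s) by case/andP: us.
(* G and D are the indicators of the event that remains when X_j = 0 and
   when X_j = 1. *)
pose k' b' := (k b' - (b == b'))%N.
pose G w : R := (counts_are s k (ones w))%:R.
pose D w : R := ((0 < k b)%N && counts_are s k' (ones w))%:R.
have mD : measurable_fun setT (fun w => (0 < k b)%N && counts_are s k' (ones w)).
  by apply: measurable_and => //; exact: measurable_counts_are.
have bG : bounded_rv G by exact/bounded_rv_bool/measurable_counts_are.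
have bD : bounded_rv D by exact: bounded_rv_bool.
have bX := bounded_rv01 j.
have local k1 x y : {in unzip2 s, x =1 y} -> counts_are s k1 x = counts_are s k1 y.
  exact: counts_are_eq.
have covG : `|cov G (X j)| <= sigma.
  apply: le_trans (cov_sum us').
  apply: (associated_cov_le (g := counts_are s k)) => //; first exact: local.
  exact: measurable_counts_are.
have covD : `|cov D (X j)| <= sigma.
  apply: le_trans (cov_sum us').
  apply: (associated_cov_le (g := fun x => (0 < k b)%N && counts_are s k' x)) => //.
  by move=> x y xy; rewrite (local _ _ y).
have -> : E (fun w => (counts_are ((b, j) :: s) k (ones w))%:R) =
    (1 - p) * E G + p * E D + cov D (X j) - cov G (X j).
  rewrite (_ : (fun w => _) = (G \+ (D \* X j)) \+ (fun w => -1 * (G \* X j) w)).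
    have bDX := bounded_rvM bD bX; have bGX := bounded_rvM bG bX.
    rewrite meanD//; [|exact: bounded_rvD|exact: bounded_rvZ].
    by rewrite meanD// (meanZ _ _ bGX) /rcov meanX; ring.
  apply/funext => w /=; rewrite counts_are_cons/= -/k' onesE /G /D.
  by case: (ones w j); rewrite /= ?mulr1 ?mulr0 ?mulN1r ?addrNK ?oppr0 ?addr0// addrAC subrr add0r.
pose prod k1 := \prod_b' binomial_weight p (count (fun q => q.1 == b') s) (k1 b').
have -> : \prod_b' binomial_weight p ((b == b') + count (fun q => q.1 == b') s) (k b') =
    (1 - p) * prod k + p * ((0 < k b)%:R * prod k').
  rewrite /prod (bigD1 b)//= eqxx add1n [in RHS](bigD1 b)//= [X in p * (_ * X)](bigD1 b)//=.
  rewrite /k' eqxx.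
  set c := count _ s.
  have e1 : \prod_(i | i != b) binomial_weight p ((b == i) + count (fun q => q.1 == i) s) (k i) =
     \prod_(i | i != b) binomial_weight p (count (fun q => q.1 == i) s) (k i).
    by apply: eq_bigr => i; rewrite eq_sym => /negbTE ->.
  have e2 : \prod_(i | i != b) binomial_weight p (count (fun q => q.1 == i) s) (k i - (b == i)) =
     \prod_(i | i != b) binomial_weight p (count (fun q => q.1 == i) s) (k i).
    by apply: eq_bigr => i; rewrite eq_sym => /negbTE ->; rewrite subn0.
  rewrite e1 e2; case: (k b) => [|kb]; first by rewrite binomial_weight0/=; ring.
  by rewrite binomial_weightS subn1/=; ring.
have sigma0 : 0 <= sigma := le_trans (normr_ge0 _) covG.
set M := 2 * sigma *+ size s.
have M0 : 0 <= M by rewrite mulrn_wge0// mulr_ge0.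
have IHG : `|E G - prod k| <= M := IH k us.
have IHD : `|E D - (0 < k b)%:R * prod k'| <= M.
  rewrite /D; case: (0 < k b)%N; first by rewrite mul1r; exact: IH.
  by rewrite /= mul0r subr0 (mean_cst P 0) normr0.
rewrite mulrSr -/M.
move: p01 IHG IHD covG covD => /andP[p0 p1].
set e1 := E G - prod k; set e2 := E D - _; set c1 := cov D _; set c2 := cov G _.
move=> He1 He2 Hc2 Hc1.
rewrite (_ : _ - _ = (1 - p) * e1 + p * e2 + c1 - c2); last by rewrite /e1 /e2; ring.
have {He1} : `|(1 - p) * e1| <= (1 - p) * M.
  by rewrite normrM ger0_norm ?subr_ge0// ler_wpM2l// subr_ge0.
have {He2} : `|p * e2| <= p * M by rewrite normrM ger0_norm// ler_wpM2l.
move: Hc1 Hc2; rewrite !ler_norml.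
move: ((1 - p) * e1) (p * e2) => a1 a2; lra.
Qed.

End associated_counts.

(** * Poisson limit of binomial laws, and lattice points in boxes *)

Section binomial_poisson.
Context (R : realType).
Implicit Types (p : nat -> R) (N : nat -> nat).

Lemma cvg_prod_seq I (r : seq I) (f : I -> nat -> R) (l : I -> R) :
  (forall i, f i n @[n --> \oo] --> l i) ->
  \prod_(i <- r) f i n @[n --> \oo] --> \prod_(i <- r) l i.
Proof.
move=> fl; elim: r => [|i r IH].
  by rewrite big_nil; under eq_fun do rewrite big_nil; exact: cvg_cst.
by rewrite big_cons; under eq_fun do rewrite big_cons; exact: cvgM.
Qed.

Lemma cvg_sum_seq I (r : seq I) (f : I -> nat -> R) (l : I -> R) :
  (forall i, f i n @[n --> \oo] --> l i) ->
  \sum_(i <- r) f i n @[n --> \oo] --> \sum_(i <- r) l i.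
Proof.
move=> fl; elim: r => [|i r IH].
  by rewrite big_nil; under eq_fun do rewrite big_nil; exact: cvg_cst.
by rewrite big_cons; under eq_fun do rewrite big_cons; exact: cvgD.
Qed.

(** Finitely many trials are negligible when the success probability tends
    to 0. *)
Lemma cvg_natB_mul p N (l : R) k :
  (forall n, 0 <= p n) -> p n @[n --> \oo] --> 0 ->
  (N n)%:R * p n @[n --> \oo] --> l -> (N n - k)%:R * p n @[n --> \oo] --> l.
Proof.
move=> p0 pcvg Npcvg.
apply: (squeeze_cvgr (f := fun n => (N n)%:R * p n - k%:R * p n)
  (h := fun n => (N n)%:R * p n)).
- near=> n; rewrite -mulrBl !ler_wpM2r ?ler_nat ?leq_subr//.
  by rewrite lerBlDr -natrD ler_nat; lia.
- rewrite -[l in _ --> l]subr0 -[X in l - X](mulr0 k%:R).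
  by apply: cvgB => //; apply: cvgM => //; exact: cvg_cst.
- by [].
Unshelve. all: by end_near. Qed.

(** Squeeze between exp(-Np) and exp(-Np/(1-p)), from 1 - p <= exp(-p) and
    1/(1-p) = 1 + p/(1-p) <= exp(p/(1-p)). *)
Lemma cvg_one_sub_exp p N (l : R) :
  (forall n, 0 <= p n) -> p n @[n --> \oo] --> 0 ->
  (N n)%:R * p n @[n --> \oo] --> l ->
  (1 - p n) ^+ N n @[n --> \oo] --> expR (- l).
Proof.
move=> p0 pcvg Npcvg.
have cvg_quot : - ((N n)%:R * p n / (1 - p n)) @[n --> \oo] --> - l.
  apply: cvgN; rewrite -[l in _ --> l]divr1; apply: cvgM => //.
  apply: cvgV; first exact: oner_neq0.
  by rewrite -[X in _ --> X]subr0; apply: cvgB => //; exact: cvg_cst.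
apply: (squeeze_cvgr (f := fun n => expR (- ((N n)%:R * p n / (1 - p n))))
  (h := fun n => expR (- ((N n)%:R * p n)))).
- have : \forall n \near \oo, p n < 1 by apply: (cvgr_lt _ pcvg); exact: ltr01.
  apply: filterS => n p1.
  have q0 : 0 < 1 - p n by rewrite subr_gt0.
  apply/andP; split.
    rewrite -mulrA -mulrN expRM_natl lerXn2r ?nnegrE ?expR_ge0 ?(ltW q0)//.
    rewrite expRN -[leRHS]invrK lef_pV2 ?posrE ?expR_gt0 ?invr_gt0//.
    rewrite [leLHS](_ : _ = 1 + p n / (1 - p n)) ?expR_ge1Dx//.
    by field; rewrite gt_eqF.
  rewrite -mulrN expRM_natl lerXn2r ?nnegrE ?expR_ge0 ?(ltW q0)//.
  exact: expR_ge1Dx.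
- exact: (cvg_comp _ _ cvg_quot (@continuous_expR R _)).
- exact: (cvg_comp _ _ (cvgN Npcvg) (@continuous_expR R _)).
Qed.

Lemma cvg_binomial_weight p N (l : R) k :
  (forall n, 0 <= p n) -> p n @[n --> \oo] --> 0 ->
  (N n)%:R * p n @[n --> \oo] --> l ->
  binomial_weight (p n) (N n) k @[n --> \oo] --> l ^+ k / k`!%:R * expR (- l).
Proof.
move=> p0 pcvg Npcvg.
rewrite /binomial_weight; apply: cvgM; last first.
  by apply: cvg_one_sub_exp => //; exact: cvg_natB_mul.
have -> : (fun n => 'C(N n, k)%:R * p n ^+ k) =
    (fun n => (\prod_(i < k) ((N n - i)%:R * p n)) / k`!%:R).
  apply/funext => n.
  rewrite big_split/= prodr_const card_ord -natr_prod -ffact_prod -bin_ffact.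
  rewrite natrM; field.
  by rewrite pnatr_eq0 -lt0n fact_gt0.
apply: cvgM; last exact: cvg_cst.
have -> : l ^+ k = \prod_(i < k) l by rewrite prodr_const card_ord.
by apply: cvg_prod_seq => i; exact: cvg_natB_mul.
Qed.

End binomial_poisson.

Section boxes.
Context (R : realType) (d : nat).
Implicit Types a b : 'I_d -> R.

(** Half-open on the left, as in [lebesgue_rV_box], so that boxes tile the
    space. *)
Definition box a b : set 'rV[R]_d :=
  [set x | forall i, x ord0 i \in `]a i, b i]%R].

(** The integers z with (n+1) a_i < z <= (n+1) b_i are floor((n+1) a_i) + 1,
    ..., floor((n+1) b_i). *)
Definition box_count n a b i : nat :=
  absz (Num.floor (n.+1%:R * b i) - Num.floor (n.+1%:R * a i)).

Definition box_site n a b (h : {dffun forall i, 'I_(box_count n a b i)}) :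
    'rV[int]_d :=
  \row_i (Num.floor (n.+1%:R * a i) + 1 + (h i : nat)%:Z).

Definition box_sites n a b : seq 'rV[int]_d :=
  [seq box_site h | h : {dffun forall i, 'I_(box_count n a b i)}].

Lemma box_sites_uniq n a b : uniq (box_sites n a b).
Proof.
rewrite map_inj_uniq ?enum_uniq// => h h' /rowP hh'.
apply/ffunP => i; apply/val_inj.
by have := hh' i; rewrite !mxE => /addrI[].
Qed.

Lemma size_box_sites n a b : size (box_sites n a b) = (\prod_i box_count n a b i)%N.
Proof.
rewrite size_image card_dep_ffun foldrE big_map big_enum/=.
by apply: eq_bigr => i _; rewrite card_ord.
Qed.

Lemma mem_box_sites n a b (j : 'rV[int]_d) : (forall i, a i <= b i) ->
  j \in box_sites n a b <-> lattice_points n (box a b) j.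
Proof.
move=> ab.
have N0 : 0 < n.+1%:R^-1 :> R by rewrite invr_gt0 ltr0n.
have boxE : lattice_points n (box a b) j <->
    forall i, Num.floor (n.+1%:R * a i) < j ord0 i <= Num.floor (n.+1%:R * b i).
  rewrite lattice_pointsE; split => H i; have := H i;
    by rewrite floor_lt_int floor_ge_int !mxE in_itv/= -ltr_pdivrMl// ler_pdivrMl//
    ?invr_gt0 ?invrK.
rewrite boxE; split => [/mapP[h _ ->] i|H].
  rewrite mxE; have : (h i < absz (Num.floor (n.+1%:R * b i) -
    Num.floor (n.+1%:R * a i)))%N := ltn_ord (h i).
  have : Num.floor (n.+1%:R * a i) <= Num.floor (n.+1%:R * b i).
    by apply: le_floor; rewrite ler_wpM2l.
  move: (nat_of_ord _) (Num.floor _) (Num.floor _) => hi u v; lia.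
have jlt i : (absz (j ord0 i - (Num.floor (n.+1%:R * a i) + 1))%R < box_count n a b i)%N.
  by have := H i; rewrite /box_count; lia.
apply/mapP; exists [ffun i => Ordinal (jlt i)]; first by rewrite mem_enum.
apply/rowP => i; rewrite !mxE ffunE/= (ord1 0).
have := H i; move: (Num.floor _) (Num.floor _) (j ord0 i) => u v z; lia.
Qed.

Lemma cvg_box_count a b i : a i <= b i ->
  (box_count n a b i)%:R / n.+1%:R @[n --> \oo] --> b i - a i.
Proof.
move=> ab.
apply: (squeeze_cvgr (f := fun n => b i - a i - n.+1%:R^-1)
  (h := fun n => b i - a i + n.+1%:R^-1)).
- near=> n.
  have N0 : 0 < n.+1%:R :> R by rewrite ltr0n.
  have fab : Num.floor (n.+1%:R * a i) <= Num.floor (n.+1%:R * b i).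
    by apply: le_floor; rewrite ler_wpM2l.
  rewrite /box_count natr_absz ger0_norm ?subr_ge0// intrB.
  rewrite ler_pdivlMr// ler_pdivrMr// !(mulrDl, mulNr) mulVf ?gt_eqF//.
  have := floor_itv (n.+1%:R * a i); have := floor_itv (n.+1%:R * b i).
  by rewrite !intrD [_ * b i]mulrC [_ * a i]mulrC; lra.
- rewrite -[X in _ --> X]subr0; apply: cvgB; [exact: cvg_cst|exact: cvg_harmonic].
- rewrite -[X in _ --> X]addr0; apply: cvgD; [exact: cvg_cst|exact: cvg_harmonic].
Unshelve. all: by end_near. Qed.

Lemma cvg_size_box_sites a b : (forall i, a i <= b i) ->
  (size (box_sites n a b))%:R / n.+1%:R ^+ d @[n --> \oo] --> \prod_i (b i - a i).
Proof.
move=> ab.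
rewrite (_ : (fun n => _) = fun n => \prod_i ((box_count n a b i)%:R / n.+1%:R)).
  by apply: cvg_prod_seq => i; exact: cvg_box_count.
apply/funext => n; rewrite size_box_sites natr_prod big_split/= prodr_const.
by rewrite card_ord exprVn.
Qed.

End boxes.

(** * A grid of half-open cells *)

Lemma continuous_measurable_borel (R : realType) (E : ptopologicalType) (f : E -> R) :
  continuous f -> measurable_fun setT (f : borel E -> R).
Proof.
move=> /continuousP cf; apply: (measurability _ (RGenOpens.measurableE R)) => _ [_ [r [s ->] <-]].
by rewrite setTI; apply: sub_sigma_algebra; exact/cf/interval_open.
Qed.

Section grid.
Context (R : realType) (d : nat).
Implicit Types (a b : 'I_d -> R) (x y : 'rV[R]_d).

Lemma norm_coord_le x i : `|x ord0 i| <= `|x|.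
Proof.
rewrite [leRHS]/Num.norm/= mx_normrE.
by apply/bigmax_geP; right => /=; exists (ord0, i).
Qed.

Lemma norm_row_le x C : 0 <= C -> (forall i, `|x ord0 i| <= C) -> `|x| <= C.
Proof.
move=> C0 xC; rewrite [leLHS]/Num.norm/= mx_normrE.
by apply/Order.TotalTheory.bigmax_leP; split => // -[i j] _; rewrite (ord1 i).
Qed.

Lemma measurable_coord i :
  measurable_fun setT ((fun x : 'rV[R]_d => x ord0 i) : borel 'rV[R]_d -> R).
Proof. by apply: continuous_measurable_borel; exact: coord_continuous. Qed.

Lemma measurable_box a b : measurable (box a b : set (borel 'rV[R]_d)).
Proof.
rewrite (_ : box a b =
    \bigcap_(i in [set: 'I_d]) (fun x => x ord0 i) @^-1` `]a i, b i]); last first.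
  by apply/seteqP; split => x H i; [move=> _|]; exact: H.
apply: fin_bigcap_measurable => // i _.
by rewrite -[X in measurable X]setTI; exact: measurable_coord.
Qed.

Lemma bounded_coords (A : set 'rV[R]_d) C :
  (forall x, A x -> forall i, `|x ord0 i| <= C) -> bounded_set A.
Proof.
move=> AC; exists `|C|; split; first exact: num_real.
move=> D CD x Ax; apply: norm_row_le => [|i].
  exact: le_trans (normr_ge0 _) (ltW CD).
by apply: le_trans (AC _ Ax i) _; apply: le_trans (ler_norm _) (ltW CD).
Qed.

Lemma bounded_box a b : bounded_set (box a b).
Proof.
apply: (@bounded_coords _ (\sum_i (`|a i| + `|b i|))) => x xab i.
rewrite (bigD1 i)//= -[leLHS]addr0; apply: lerD; last first.
  by apply: sumr_ge0 => j _; rewrite addr_ge0.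
have := xab i; rewrite in_itv/= => /andP[ax xb].
rewrite ler_norml; move: (ler_norm (b i)) (ler_norm (- a i)).
by rewrite normrN; have := normr_ge0 (a i); have := normr_ge0 (b i); lra.
Qed.

(** Cells of side 1/(m+1) tiling ]-(m+1), m+1]^d; h gives the position of a
    cell along each axis, counted from -(m+1). *)
Definition grid m : finType := {ffun 'I_d -> 'I_(2 * m.+1 * m.+1)}.

Definition grid_lo m (h : grid m) i : R := (h i)%:R / m.+1%:R - m.+1%:R.
Definition grid_hi m (h : grid m) i : R := (h i).+1%:R / m.+1%:R - m.+1%:R.
Definition cell m (h : grid m) : set 'rV[R]_d := box (grid_lo h) (grid_hi h).

Lemma grid_hiE m (h : grid m) i : grid_hi h i = grid_lo h i + m.+1%:R^-1.
Proof. by rewrite /grid_hi /grid_lo -addn1 natrD mulrDl mul1r addrAC. Qed.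

Lemma grid_lo_lt m (h : grid m) i : grid_lo h i < grid_hi h i.
Proof. by rewrite grid_hiE ltrDl invr_gt0 ltr0n. Qed.

Lemma measurable_cell m (h : grid m) : measurable (cell h : set (borel 'rV[R]_d)).
Proof. exact: measurable_box. Qed.

Lemma cell_inj m (h h' : grid m) x : cell h x -> cell h' x -> h = h'.
Proof.
move=> xh xh'; apply/ffunP => i; apply/val_inj.
have M0 : 0 < m.+1%:R :> R by rewrite ltr0n.
move: (xh i) (xh' i); rewrite !in_itv/= /grid_lo /grid_hi.
rewrite !ltrBlDr !lerBrDr !ltr_pdivrMr// !ler_pdivlMr//.
move=> /andP[a b] /andP[a' b'].
have := lt_le_trans a b'; have := lt_le_trans a' b; rewrite !ltr_nat !ltnS => *.
by apply/eqP; rewrite eqn_leq; apply/andP.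
Qed.

Lemma cell_cover m x : (forall i, `|x ord0 i| < m.+1%:R) -> exists h : grid m, cell h x.
Proof.
move=> xM.
have M0 : 0 < m.+1%:R :> R by rewrite ltr0n.
pose z i := Num.ceil ((x ord0 i + m.+1%:R) * m.+1%:R).
have zP i : 1 <= z i <= (2 * m.+1 * m.+1)%N%:Z.
  have := xM i; rewrite ltr_norml => /andP[x1 x2].
  rewrite -(gtz0_ge1) /z ceil_gt0 ceil_le_int -!pmulrn !natrM.
  rewrite mulr_gt0//=; last by rewrite -ltrBlDr sub0r.
  by rewrite ler_wpM2r// mulr_natl mulr2n lerD2r ltW.
have zlt i : (absz (z i - 1)%R < 2 * m.+1 * m.+1)%N.
  by have := zP i; move: (z i) (2 * m.+1 * m.+1)%N => u v; lia.
exists [ffun i => Ordinal (zlt i)] => i; rewrite in_itv/= /grid_lo /grid_hi ffunE/=.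
have [z1 z2] : (absz (z i - 1)%R)%:R = (z i - 1)%:~R :> R /\
    (absz (z i - 1)%R).+1%:R = (z i)%:~R :> R.
  split; rewrite pmulrn; congr (_ %:~R); have := zP i; move: (z i) => u; lia.
rewrite z1 z2 ltrBlDr lerBrDr ltr_pdivrMr// ler_pdivlMr//.
by have := ceil_itv ((x ord0 i + m.+1%:R) * m.+1%:R).
Qed.

Lemma cell_dist m (h : grid m) x y : cell h x -> cell h y ->
  `|x - y| <= m.+1%:R^-1.
Proof.
move=> xh yh; apply: norm_row_le => [|i]; first by rewrite invr_ge0.
move: (xh i) (yh i); rewrite !mxE !in_itv/= !grid_hiE ler_norml.
by move: (grid_lo h i) => u; move: m.+1%:R^-1 => v; lra.
Qed.

Definition cell_point m (h : grid m) : 'rV[R]_d := \row_i grid_hi h i.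

Lemma cell_pointP m (h : grid m) : cell h (cell_point h).
Proof. by move=> i; rewrite mxE in_itv/= grid_lo_lt lexx. Qed.

Definition step m (c : grid m -> R) x : R := \sum_h c h * \1_(cell h) x.

Lemma step_cell m c (h : grid m) x : cell h x -> step c x = c h.
Proof.
move=> xh; rewrite /step (bigD1 h)//= indicE mem_set// mulr1 big1 ?addr0// => h' hh'.
rewrite indicE memNset ?mulr0// => xh'.
by move/eqP: hh'; apply; exact: cell_inj xh' xh.
Qed.

Lemma step_out m (c : grid m -> R) x : (forall h : grid m, ~ cell h x) -> step c x = 0.
Proof. by move=> xh; rewrite /step big1// => h _; rewrite indicE memNset ?mulr0. Qed.

Lemma measurable_step m (c : grid m -> R) :
  measurable_fun setT (@step m c : borel 'rV[R]_d -> R).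
Proof.
apply: measurable_sum => h; apply: measurable_funM => //.
by apply: measurable_indic; exact: measurable_cell.
Qed.

Lemma integral_step (nu : lfmeasure R d) m (c : grid m -> R) :
  (forall h, 0 <= c h) ->
  (\int[nu]_x (step c x)%:E = \sum_h (c h)%:E * nu (cell h))%E.
Proof.
move=> c0.
under eq_integral do rewrite /step -sumEFin.
rewrite ge0_integral_sum//; last 2 first.
- move=> h; apply/measurable_EFinP; apply: measurable_funM => //.
  by apply: measurable_indic; exact: measurable_cell.
- by move=> h x _; rewrite lee_fin mulr_ge0.
apply: eq_bigr => h _; under eq_integral do rewrite EFinM.
rewrite ge0_integralZl//; last 2 first.
- by apply/measurable_EFinP; apply: measurable_indic; exact: measurable_cell.
- by rewrite lee_fin.
by rewrite integral_indic// ?setIT//; exact: measurable_cell.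
Qed.

End grid.

(** * Integrals of test functions and masses of cells *)

Section vague.
Context (R : realType) (d : nat).
Implicit Types (f : 'rV[R]_d -> R) (nu : lfmeasure R d).

Lemma measurable_test f :
  continuous f -> measurable_fun setT ((fun x => (f x)%:E) : borel 'rV[R]_d -> \bar R).
Proof. by move=> cf; apply/measurable_EFinP; exact: continuous_measurable_borel. Qed.

(** Uniform continuity: a test function vanishes outside a compact cube, which
    finitely many balls of small oscillation cover. *)
Lemma test_cell_oscillation f : vague_test f -> forall e, 0 < e ->
  \forall m \near \oo, forall (h : grid d m) x y, cell h x -> cell h y ->
    `|f x - f y| <= e.
Proof.
move=> [cf _ [C [_ fC]]] e e0.
have {}fC x : f x != 0 -> `|x| <= C + 1 by apply: fC; rewrite ltrDl.
pose K := [set v : 'rV[R]_d | forall i, v ord0 i \in `[(- (C + 1)), (C + 1)]%R].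
have cK : compact K.
  by apply: (@rV_compact _ _ (fun=> `[(- (C + 1)), (C + 1)]%classic)) => _; exact: segment_compact.
have fK x : ~ K x -> f x = 0.
  move=> nK; apply/eqP/negP => /negP /fC xC; apply: nK => i.
  by rewrite in_itv/= -ler_norml; exact: le_trans (norm_coord_le x i) xC.
have /compact_near_coveringP/(_ nat \oo
  (fun m x => forall y, `|x - y| <= m.+1%:R^-1 -> `|f x - f y| <= e)) := cK.
move=> cov; refine (filterS _ (cov _ _)); last first.
  move=> x Kx.
  have e2 : 0 < e / 2 by rewrite divr_gt0.
  have /cvgrPdist_lt/(_ _ e2)/nbhs_ballP[r r0 fr] := cf x.
  have r2 : 0 < r / 2 by rewrite divr_gt0.
  exists (ball x (r / 2), [set m : nat | m.+1%:R^-1 < r / 2]).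
    split => /=; first exact: nbhsx_ballx.
    by have /cvgr_lt/(_ _ r2) := @cvg_harmonic R.
  move=> [x' m]/= [xx' mr] y x'y.
  have xx'r : `|x - x'| < r / 2 by rewrite -ball_normE in xx'.
  have fx' : `|f x - f x'| < e / 2.
    apply: fr; rewrite -ball_normE/=; apply: (lt_le_trans xx'r).
    by rewrite ler_pdivrMr// ler_peMr ?ler1n// ltW.
  have fy : `|f x - f y| < e / 2.
    apply: fr; rewrite -ball_normE/= -(subrKA x') (splitr r).
    by apply: le_lt_trans (ler_normD _ _) (ltrD xx'r _); exact: le_lt_trans x'y mr.
  rewrite -(subrKA (f x)) (splitr e).
  by apply: le_trans (ler_normD _ _) (lerD _ (ltW fy)); rewrite distrC ltW.
move=> m mK h x y hx hy.
have [Kx|nKx] := pselect (K x); first exact/mK/(cell_dist hx hy).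
have [Ky|nKy] := pselect (K y); first by rewrite distrC; exact/mK/(cell_dist hy hx).
by rewrite !fK// subrr normr0 ltW.
Qed.

Definition same_cells m nu nu' := forall h : grid d m, nu (cell h) = nu' (cell h).

Lemma integral_step_same m nu nu' (c : grid d m -> R) : (forall h, 0 <= c h) ->
  same_cells m nu nu' ->
  (\int[nu]_x (step c x)%:E = \int[nu']_x (step c x)%:E)%E.
Proof. by move=> c0 nn; rewrite !integral_step//; apply: eq_bigr => h _; rewrite nn. Qed.

(** Up to delta times the indicator of the cells that meet its support, f is a
    step function, whose integral depends on the masses of the cells only. The
    total mass of these cells is at most nu B for one bounded box B, which does
    not depend on m. *)
Lemma integral_same_cells f nu : vague_test f -> forall e, 0 < e ->
  \forall m \near \oo, forall nu', same_cells m nu nu' ->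
    (\int[nu]_x (f x)%:E <= \int[nu']_x (f x)%:E + e%:E)%E /\
    (\int[nu']_x (f x)%:E <= \int[nu]_x (f x)%:E + e%:E)%E.
Proof.
move=> tf e e0; have [cf f0 [C [_ fC]]] := tf.
have {}fC x : f x != 0 -> `|x| <= C + 1 by apply: fC; rewrite ltrDl.
pose B : set 'rV[R]_d := box (fun=> - (C + 3)) (fun=> C + 3).
pose V := fine (nu B).
have nuB : nu B = V%:E.
  rewrite /V fineK// ge0_fin_numE//; apply: lfmP; last exact: bounded_box.
  exact: measurable_box.
have V0 : 0 <= V by rewrite /V fine_ge0.
pose delta := e / (2 * (V + 1)).
have d0 : 0 < delta by rewrite /delta divr_gt0// mulr_gt0// ltr_wpDl.
have dV : 2 * delta * V <= e.
  rewrite /delta (_ : 2 * _ * V = e * (V / (V + 1))).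
    by rewrite ler_piMr// ?(ltW e0)// ler_pdivrMr ?mul1r ?lerDl// ltr_wpDl.
  by field; rewrite gt_eqF// ltr_wpDl.
have Cm : \forall m \near \oo, C + 2 < m.+1%:R.
  exists (Num.bound (C + 2)) => // m /= mC.
  have [/ltW C0|C0] := ltP (C + 2) 0; first by apply: le_lt_trans C0 _; rewrite ltr0n.
  apply: lt_le_trans (archi_boundP C0) _.
  by rewrite ler_nat (leq_trans mC).
near=> m => nu' nn.
have osc : forall (h : grid d m) x y, cell h x -> cell h y -> `|f x - f y| <= delta.
  by near: m; exact: test_cell_oscillation.
have CM : C + 2 < m.+1%:R by near: m.
pose c (h : grid d m) := f (cell_point R h).
pose q (h : grid d m) : R := `[< exists2 x, cell h x & f x != 0 >]%:R.
have c0 h : 0 <= c h by exact: f0.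
have q0 h : 0 <= q h by [].
(* f <= step ce and step c <= f + delta * step q: on the cells with q = 0 both
   f and c vanish. *)
pose ce h := c h + delta * q h.
have ce0 h : 0 <= ce h by rewrite addr_ge0// mulr_ge0// ltW.
have step_ce x : step ce x = step c x + delta * step q x.
  rewrite /step mulr_sumr -big_split/=; apply: eq_bigr => h _.
  by rewrite /ce mulrDl mulrA.
have cells x : (exists h : grid d m, cell h x) \/
    (forall h : grid d m, ~ cell h x) /\ f x = 0.
  have [[h xh]|nh] := pselect (exists h : grid d m, cell h x); [by left; exists h|right].
  split; first by move=> h xh; apply: nh; exists h.
  apply/eqP/negP => /negP /fC xC; apply: nh; apply: cell_cover => i.
  apply: le_lt_trans (norm_coord_le x i) _; apply: le_lt_trans xC _.
  by apply: lt_trans CM; rewrite ltrD2l ltr1n.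
have bounds x : f x <= step ce x /\ step c x <= f x + delta * step q x.
  have [[h xh]|[nh fx]] := cells x; last first.
    by rewrite !step_out// fx mulr0 addr0.
  rewrite !(step_cell _ xh) /ce /c /q.
  have := osc h _ _ xh (cell_pointP R h); rewrite ler_norml => osch.
  case: asboolP => [_|nq]; first by rewrite mulr1; lra.
  have -> : f x = 0 by apply/eqP/negP => /negP fx; apply: nq; exists x.
  have -> : f (cell_point R h) = 0.
    by apply/eqP/negP => /negP fx; apply: nq; exists (cell_point R h) => //; exact: cell_pointP.
  by rewrite mulr0 addr0.
have qB x : step q x <= \1_B x.
  have [[h xh]|[nh fx]] := cells x; last by rewrite step_out.
  rewrite (step_cell _ xh) /q; case: asboolP => // -[y yh /fC yC].
  rewrite indicE mem_set// => i; rewrite in_itv/=.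
  have : `|x ord0 i| <= C + 2.
    apply: le_trans (norm_coord_le x i) _; rewrite -(subrK y x).
    apply: le_trans (ler_normD _ _) _.
    have : m.+1%:R^-1 <= 1 :> R by rewrite invf_le1 ?ler1n// ltr0n.
    move=> M1; apply: le_trans (lerD (cell_dist xh yh) yC) _.
    by move: M1; move: (_^-1) => u; lra.
  by rewrite ler_norml; lra.
have mstep (u : grid d m -> R) :
    measurable_fun setT ((fun x => (step u x)%:E) : borel 'rV[R]_d -> \bar R).
  by apply/measurable_EFinP; exact: measurable_step.
have step0 (u : grid d m -> R) x : (forall h, 0 <= u h) -> 0 <= step u x.
  by move=> u0; apply: sumr_ge0 => h _; rewrite mulr_ge0.
have mf := measurable_test cf.
have one nu1 nu2 : same_cells m nu1 nu2 -> same_cells m nu nu1 ->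
    (\int[nu1]_x (f x)%:E <= \int[nu2]_x (f x)%:E + e%:E)%E.
  move=> n12 n1.
  have Iq nu3 : same_cells m nu nu3 -> (\int[nu3]_x (step q x)%:E <= V%:E)%E.
    move=> n3; rewrite -(integral_step_same q0 n3) -nuB.
    rewrite (_ : nu B = \int[nu]_x (\1_B x)%:E)%E; last first.
      by rewrite integral_indic// ?setIT//; exact: measurable_box.
    apply: ge0_le_integral => //; first by move=> x _; rewrite lee_fin step0.
      by apply/measurable_EFinP; apply: measurable_indic; exact: measurable_box.
    by move=> x _; rewrite lee_fin.
  have n2 : same_cells m nu nu2 by move=> h; rewrite n1 n12.
  have I1 : (\int[nu1]_x (f x)%:E <= \int[nu1]_x (step ce x)%:E)%E.
    apply: ge0_le_integral => //; first by move=> x _; rewrite lee_fin.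
    by move=> x _; rewrite lee_fin; case: (bounds x).
  have Iqf nu3 (u : 'rV[R]_d -> R) : (forall x, 0 <= u x) ->
      measurable_fun setT ((fun x => (u x)%:E) : borel 'rV[R]_d -> \bar R) ->
      (\int[nu3]_x (u x + delta * step q x)%:E =
      \int[nu3]_x (u x)%:E + delta%:E * \int[nu3]_x (step q x)%:E)%E.
    move=> u0 mu; under eq_integral do rewrite EFinD EFinM.
    rewrite ge0_integralD//; last 3 first.
    - by move=> x _; rewrite lee_fin.
    - by move=> x _; rewrite -EFinM lee_fin mulr_ge0 ?(ltW d0)// step0.
    - by apply: measurable_funeM.
    by rewrite ge0_integralZl//; [move=> x _; rewrite lee_fin step0|rewrite lee_fin ltW].
  have I2 : (\int[nu1]_x (step ce x)%:E <= \int[nu1]_x (step c x)%:E + (delta * V)%:E)%E.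
    under eq_integral do rewrite step_ce.
    rewrite Iqf//; last by move=> x; exact: step0.
    apply: leeD2l; rewrite (EFinM delta); apply: lee_wpmul2l; last exact: Iq.
    by rewrite lee_fin ltW.
  have I3 : (\int[nu2]_x (step c x)%:E <= \int[nu2]_x (f x)%:E + (delta * V)%:E)%E.
    apply: (@le_trans _ _ (\int[nu2]_x (f x + delta * step q x)%:E)%E).
      apply: ge0_le_integral => //.
      - by move=> x _; rewrite lee_fin step0.
      - apply/measurable_EFinP; apply: measurable_funD; first exact/measurable_EFinP.
        by apply: measurable_funM => //; exact: measurable_step.
      - by move=> x _; rewrite lee_fin; case: (bounds x).
    rewrite Iqf//.
    apply: leeD2l; rewrite (EFinM delta); apply: lee_wpmul2l; last exact: Iq.
    by rewrite lee_fin ltW.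
  apply: (le_trans I1); apply: (le_trans I2).
  rewrite (integral_step_same c0 n12).
  apply: (@le_trans _ _ (\int[nu2]_x (f x)%:E + (delta * V)%:E + (delta * V)%:E)%E).
    exact: leeD2r.
  by rewrite -addeA -EFinD; apply: leeD2l; rewrite lee_fin; lra.
by split; apply: one => // h; rewrite nn.
Unshelve. all: by end_near. Qed.

End vague.

(** * Vague continuity and measurability *)

Section vague_measurability.
Context (R : realType) (d : nat).
Implicit Types (f : 'rV[R]_d -> R) (nu : lfmeasure R d) (a b : 'I_d -> R)
  (x : 'rV[R]_d).

(** A neighbourhood of nu is cut out by finitely many integrals of test
    functions, and each of them is nearly fixed by the cells of a fine grid. *)
Lemma vague_continuous_same_cells (F : lfmeasure R d -> R) nu e :
  continuous F -> 0 < e ->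
  \forall m \near \oo, forall nu', same_cells m nu nu' -> F nu - e < F nu'.
Proof.
move=> cF e0.
have : open (F @^-1` [set y | F nu - e < y]).
  by move/continuousP : cF; apply; exact: open_gt.
move=> [/= D' D'sub D'E].
have : (F @^-1` [set y | F nu - e < y]) nu by rewrite /= ltrBlDr ltrDl.
rewrite -D'E => -[B D'B Bnu].
have [S Ssub SB] := D'sub _ D'B.
pose sub (i : ('rV[R]_d -> R) * (R * R)) : set (lfmeasure R d) :=
  [set nu' : lfmeasure R d | (i.2.1%:E < \int[nu']_x (i.1 x)%:E < i.2.2%:E)%E].
have near_sub i : i \in S ->
    \forall m \near \oo, forall nu', same_cells m nu nu' -> sub i nu'.
  case: i => [f [s t]] iS.
  have tf : vague_test f by have := Ssub _ iS; rewrite inE.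
  have : sub (f, (s, t)) nu by move: Bnu; rewrite -SB; apply.
  rewrite /sub /= => /andP[].
  case Ir : (\int[nu]_x (f x)%:E)%E => [r| |] //.
  rewrite !lte_fin => sr rt.
  (* Half of the distance from the integral r to the ends of ]s, t[. *)
  pose e' := Num.min (r - s) (t - r) / 2.
  have e'0 : 0 < e' by rewrite divr_gt0// lt_min !subr_gt0 sr rt.
  have e'r : e' < r - s /\ e' < t - r.
    have : e' < Num.min (r - s) (t - r) by rewrite /e' gtr_pMr ?invf_lt1 ?ltr1n// lt_min !subr_gt0 sr.
    by rewrite lt_min => /andP.
  have := integral_same_cells nu tf e'0; apply: filterS => m H nu' nn.
  have [] := H _ nn; rewrite Ir.
  case: (\int[nu']_x (f x)%:E)%E => [r'| |]//.
    rewrite -!EFinD !lee_fin !lte_fin => H1 H2.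
    by case: e'r => ? ?; apply/andP; split; lra.
have near_all : \forall m \near \oo, forall i, i \in S ->
    forall nu', same_cells m nu nu' -> sub i nu'.
  have capS := filter_bigI eventually_filter near_sub.
  by refine (filterS _ capS) => m mS i iS; exact: mS.
apply: filterS near_all => m mS nu' nn.
have -> : (F nu - e < F nu') = true; last by [].
suff : (F @^-1` [set y | F nu - e < y]) nu' by [].
rewrite -D'E; exists B => //; rewrite -SB => i iS.
exact: (mS i iS nu' nn).
Qed.

(** Since the integral is finite, the condition r < integral is a countable
    union of sets of the subbase. *)
Lemma measurable_vague_integral f : vague_test f ->
  (forall nu, (\int[nu]_x (f x)%:E < +oo)%E) ->
  measurable_fun setT
    ((fun nu => \int[nu]_x (f x)%:E)%E : borel (lfmeasure R d) -> \bar R).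
Proof.
move=> tf foo.
apply: (measurability _ (ErealGenOInfty.measurableE R)) => _ [_ [r ->] <-].
rewrite setTI (_ : _ @^-1` _ = \bigcup_n
    [set nu : lfmeasure R d | (r%:E < \int[nu]_x (f x)%:E < n%:R%:E)%E]); last first.
  apply/seteqP; split => nu /=; rewrite ?in_itv/= ?andbT; last first.
    by move=> [n _ /andP[rI _]].
  move=> rI; have := foo nu.
  case Ir : (\int[nu]_x (f x)%:E)%E rI => [s| |]// rI _.
  exists (Num.bound `|s|) => //=; rewrite Ir rI/= lte_fin.
  by apply: le_lt_trans (ler_norm s) _; exact: archi_boundP.
apply: bigcup_measurable => n _; apply: sub_sigma_algebra.
pose sub (i : ('rV[R]_d -> R) * (R * R)) : set (lfmeasure R d) :=
  [set nu' : lfmeasure R d | (i.2.1%:E < \int[nu']_x (i.1 x)%:E < i.2.2%:E)%E].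
exists [set (sub (f, (r, n%:R)))]; last by rewrite bigcup_set1.
move=> _ ->; exact: (@finI_from1 _ _ _ sub (f, (r, n%:R))).
Qed.

(** Continuous functions that are 0 outside ]s, t + 1/k] and converge to the
    indicator of ]s, t] as k grows. *)
Definition trapezoid (k s t u : R) : R :=
  Num.max 0 (Num.min 1 (Num.min (k * (u - s)) (1 + k * (t - u)))).

Lemma continuous_trapezoid k s t : continuous (trapezoid k s t).
Proof.
move=> u.
have lin1 : {for u, continuous ((fun v => k * (v - s)) : R -> R^o)}.
  apply: cvgM; first exact: cvg_cst.
  by apply: cvgB; [exact: cvg_id|exact: cvg_cst].
have lin2 : {for u, continuous ((fun v => 1 + k * (t - v)) : R -> R^o)}.
  apply: cvgD; first exact: cvg_cst.
  apply: cvgM; first exact: cvg_cst.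
  by apply: cvgB; [exact: cvg_cst|exact: cvg_id].
have cst_cont c : {for u, continuous (cst c : R -> R^o)} by exact: cst_continuous.
exact: continuous_max (cst_cont 0)
  (continuous_min (cst_cont 1) (continuous_min lin1 lin2)).
Qed.

Lemma trapezoid_itv k s t u : 0 <= trapezoid k s t u <= 1.
Proof. by rewrite le_max lexx/= ge_max ler01/= ge_min lexx. Qed.

Lemma trapezoid_neq0 n s t u :
  trapezoid n.+1%:R s t u != 0 -> s < u <= t + 1.
Proof.
apply: contraNT; rewrite negb_and -leNgt -ltNge => su.
rewrite /trapezoid; apply/eqP/max_idPl; rewrite ge_min; apply/orP; right.
rewrite ge_min; case/orP: su => [us|tu]; apply/orP; [left|right].
  by rewrite mulr_ge0_le0// subr_le0.
have n1 : 1 <= n.+1%:R :> R by rewrite ler1n.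
have : n.+1%:R * (t + 1 - u) <= 0 by rewrite mulr_ge0_le0// subr_le0 ltW.
by move: (n.+1%:R) n1 => v; lra.
Qed.

Lemma cvg_trapezoid s t u :
  trapezoid n.+1%:R s t u @[n --> \oo] --> ((u \in `]s, t]%R)%:R : R).
Proof.
have large (v : R) : 0 < v -> \forall n \near \oo, 1 <= n.+1%:R * v.
  move=> v0; have /cvgr_lt/(_ _ v0) := @cvg_harmonic R.
  by apply: filterS => n /=; rewrite -[ltLHS]mulr1 ltr_pdivrMl ?ltr0n// => /ltW.
rewrite in_itv/=; have [us|su] /= := leP u s.
  apply: cvg_near_cst; apply: nearW => n.
  rewrite /trapezoid; apply/max_idPl; rewrite !ge_min.
  by rewrite mulr_ge0_le0 ?subr_le0// !orbT.
have [ut|tu] /= := leP u t.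
  have := @large (u - s); rewrite subr_gt0 => /(_ su).
  move=> large1; apply: cvg_near_cst; apply: filterS large1 => n nus.
  rewrite /trapezoid min_l; first by rewrite max_r.
  by rewrite le_min nus lerDl mulr_ge0// subr_ge0.
have := @large (u - t); rewrite subr_gt0 => /(_ tu).
move=> large1; apply: cvg_near_cst; apply: filterS large1 => n nus.
rewrite /trapezoid; apply/max_idPl; rewrite !ge_min; apply/orP; right; apply/orP; right.
by rewrite -opprB mulrN subr_le0.
Qed.

Definition box_test n a b x : R := \prod_i trapezoid n.+1%:R (a i) (b i) (x ord0 i).

Lemma box_test_itv n a b x : 0 <= box_test n a b x <= \1_(box a (fun i => b i + 1)) x.
Proof.
apply/andP; split.
  by apply: prodr_ge0 => i _; case/andP: (trapezoid_itv n.+1%:R (a i) (b i) (x ord0 i)).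
have [/prodf_neq0 H|] := boolP (box_test n a b x != 0); last first.
  by rewrite negbK => /eqP ->.
rewrite indicE mem_set; last first.
  by move=> i; rewrite in_itv/=; apply: trapezoid_neq0 (H i _).
apply: prodr_ile1 => i _; exact: trapezoid_itv.
Qed.

Lemma vague_test_box n a b : vague_test (box_test n a b).
Proof.
split.
- apply: (@continuous_big R _ *%R 1 xpredT (@mul_continuous R)) => i _ x.
  apply: (continuous_comp (@coord_continuous _ _ _ ord0 i x)).
  exact: continuous_trapezoid.
- by move=> x; case/andP: (box_test_itv n a b x).
- have [M [M_real HM]] := bounded_box a (fun i => b i + 1).
  exists M; split => // C MC x x0; apply: HM MC _ _.
  apply: contrapT => nx; move: x0 => /= /eqP; apply; apply/eqP.
  by have := box_test_itv n a b x; rewrite indicE memNset// eq_le andbC.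
Qed.

Lemma cvg_box_test a b x : box_test n a b x @[n --> \oo] --> (\1_(box a b) x : R).
Proof.
have -> : \1_(box a b) x = \prod_i (x ord0 i \in `]a i, b i]%R)%:R :> R.
  rewrite indicE; have [xab|xab] := pselect (box a b x).
    by rewrite mem_set// big1// => i _; rewrite xab.
  rewrite memNset//; apply/esym/eqP/prodf_eq0.
  by have /existsNP[i /negP/negbTE xi] := xab; exists i => //; rewrite xi.
apply: cvg_prod_seq => i; exact: cvg_trapezoid.
Qed.

(** The indicator of a box is a pointwise limit of test functions dominated by
    the indicator of a larger box, so dominated convergence applies for each
    nu. *)
Lemma measurable_lfm_box a b :
  measurable_fun setT ((fun nu => nu (box a b)) : borel (lfmeasure R d) -> \bar R).
Proof.
pose B := box a (fun i => b i + 1).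
have mB : measurable (B : set (borel 'rV[R]_d)) by exact: measurable_box.
have mI (A : set (borel 'rV[R]_d)) : measurable A ->
  measurable_fun setT ((fun x => (\1_A x)%:E) : borel 'rV[R]_d -> \bar R).
  by move=> mA; apply/measurable_EFinP; exact: measurable_indic.
have nuB nu : (nu B < +oo)%E by apply: lfmP => //; exact: bounded_box.
have mt n : measurable_fun setT ((fun x => (box_test n a b x)%:E) : borel 'rV[R]_d -> \bar R).
  by apply: measurable_test; case: (vague_test_box n a b).
apply: (@emeasurable_fun_cvg _ (borel (lfmeasure R d)) R setT
  (fun n nu => \int[nu : lfmeasure R d]_x (box_test n a b x)%:E)%E) => [n|nu _].
  apply: measurable_vague_integral; first exact: vague_test_box.
  move=> nu; apply: le_lt_trans (nuB nu).
  rewrite (_ : nu B = \int[nu]_x (\1_B x)%:E)%E; last first.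
    by rewrite integral_indic// setIT.
  apply: ge0_le_integral => //; last 2 first.
  - exact: mI.
  - by move=> x _; rewrite lee_fin; case/andP: (box_test_itv n a b x).
  by move=> x _; rewrite lee_fin; case/andP: (box_test_itv n a b x).
have -> : nu (box a b) = (\int[nu]_x (\1_(box a b) x)%:E)%E.
  by rewrite integral_indic ?setIT//; exact: measurable_box.
have [] := @dominated_convergence _ (borel 'rV[R]_d) R nu setT measurableT
  (fun n x => (box_test n a b x)%:E) (fun x => (\1_(box a b) x)%:E)
  (fun x => (\1_B x)%:E) mt (mI _ (measurable_box a b)).
- by apply: aeW => x _; apply: cvg_EFin; [exact: nearW|exact: cvg_box_test].
- apply/integrableP; split; first exact: mI.
  under eq_integral do rewrite gee0_abs//.
  by rewrite integral_indic// setIT.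
- apply: aeW => x n _ /=; rewrite lee_fin.
  by have /andP[t0 t1] := box_test_itv n a b x; rewrite ger0_norm.
by [].
Qed.

End vague_measurability.

(** * Weak convergence from convergence of cell counts *)

Section dominated_means.
Context d (T : measurableType d) (R : realType) (P : probability T R).

Lemma cvg_mean_bounded (f : nat -> T -> R) (g : T -> R) (C : R) :
  (forall n, measurable_fun setT (f n)) -> measurable_fun setT g ->
  (forall n w, `|f n w| <= C) ->
  {ae P, forall w, f n w @[n --> \oo] --> g w} ->
  mean P (f n) @[n --> \oo] --> mean P g.
Proof.
move=> mf mg fC fg.
have [] := @dominated_convergence _ T R P setT measurableT
  (fun n w => (f n w)%:E) (fun w => (g w)%:E) (fun=> C%:E).
- by move=> n; exact/measurable_EFinP.
- exact/measurable_EFinP.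
- by apply: filterS fg => w H _; apply: cvg_EFin; first exact: nearW.
- exact: (bounded_rv_integrable P (bounded_rv_cst _ C)).
- by apply: aeW => w n _; rewrite lee_fin.
move=> ig _ H; apply: fine_cvg; rewrite /mean /Rintegral fineK//.
exact: integrable_fin_num.
Qed.

End dominated_means.

Section cell_counts.
Context (R : realType) (d : nat).
Implicit Types (nu : lfmeasure R d).

Definition cell_counts m (k : grid d m -> nat) : set (lfmeasure R d) :=
  [set nu | forall h, nu (cell h) = (k h)%:R%:E].

Lemma cell_counts_inj m (k k' : grid d m -> nat) nu :
  cell_counts k nu -> cell_counts k' nu -> k =1 k'.
Proof.
move=> nk nk' h; have := nk h; rewrite nk' => -[] /eqP.
by rewrite eqr_nat => /eqP.
Qed.

Lemma cell_counts_same m (k : grid d m -> nat) nu nu' :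
  cell_counts k nu -> cell_counts k nu' <-> same_cells m nu nu'.
Proof.
by move=> nk; split => [nk' h|nn h]; [rewrite nk nk'|rewrite -nn nk].
Qed.

Lemma measurable_cell_counts m (k : grid d m -> nat) :
  measurable (cell_counts k : set (borel (lfmeasure R d))).
Proof.
rewrite (_ : cell_counts k = \bigcap_(h in [set: grid d m])
    (fun nu : lfmeasure R d => nu (cell h)) @^-1` [set (k h)%:R%:E]); last first.
  by apply/seteqP; split => nu H h; [move=> _|]; exact: H.
apply: fin_bigcap_measurable => // h _.
by rewrite -[X in measurable X]setTI; apply: measurable_lfm_box.
Qed.

Context (F : lfmeasure R d -> R) (C : R).
Hypothesis cF : continuous F.
Hypothesis FC : forall nu, 0 <= F nu <= C.

(** Here inf set0 = 0, so the value is nonnegative even when no measure has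
    the counts k. *)
Definition counts_inf m (k : grid d m -> nat) : R := inf (F @` cell_counts k).

Lemma counts_inf_ge0 m (k : grid d m -> nat) : 0 <= counts_inf k.
Proof.
rewrite /counts_inf; have [[x Fx]|n0] := pselect (F @` cell_counts k !=set0).
  apply: lb_le_inf; first by exists x.
  by move=> _ [nu _ <-]; case/andP: (FC nu).
rewrite (_ : F @` _ = set0) ?inf0//; apply/seteqP; split => // x Fx.
by apply: n0; exists x.
Qed.

Lemma counts_inf_le m (k : grid d m -> nat) nu : cell_counts k nu -> counts_inf k <= F nu.
Proof.
move=> nk; apply: ge_inf; last by exists nu.
by exists 0 => _ [nu' _ <-]; case/andP: (FC nu').
Qed.

Lemma counts_inf_eq m (k k' : grid d m -> nat) nu :
  cell_counts k nu -> cell_counts k' nu -> counts_inf k = counts_inf k'.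
Proof.
by move=> nk nk'; congr counts_inf; apply/funext; exact: cell_counts_inj nk nk'.
Qed.

(** The part of [lower_env] carried by the finitely many count vectors below
    K: a simple function of the cell counts, whose mean is a finite sum of
    probabilities. *)
Definition lower_env_trunc m K nu : R :=
  \sum_(k : {ffun grid d m -> 'I_K})
    counts_inf (fun h => k h : nat) * \1_(cell_counts (fun h => k h : nat)) nu.

(** The infimum of F over the measures with the same cell masses as nu, when
    these are natural numbers. *)
Definition lower_env m nu : R :=
  if pselect (exists k, cell_counts k nu) is left ex
  then counts_inf (sval (cid ex) : grid d m -> nat) else 0.

Lemma lower_envE m (k : grid d m -> nat) nu : cell_counts k nu ->
  lower_env m nu = counts_inf k.
Proof.
move=> nk; rewrite /lower_env; case: pselect => [ex|[]]; last by exists k.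
by case: cid => k' nk' /=; exact: counts_inf_eq nk' nk.
Qed.

Lemma lower_env_truncE m K (k : {ffun grid d m -> 'I_K}) nu :
  cell_counts (fun h => k h : nat) nu -> lower_env_trunc m K nu = lower_env m nu.
Proof.
move=> nk; rewrite /lower_env_trunc (bigD1 k)//= indicE mem_set// mulr1.
rewrite (lower_envE nk) big1 ?addr0// => k' kk'.
rewrite indicE memNset ?mulr0// => nk'; move/eqP : kk'; apply.
by apply/ffunP => h; apply/val_inj; exact: cell_counts_inj nk' nk h.
Qed.

Lemma lower_env_trunc_out m K nu :
  (forall k : {ffun grid d m -> 'I_K}, ~ cell_counts (fun h => k h : nat) nu) ->
  lower_env_trunc m K nu = 0.
Proof. by move=> nk; rewrite /lower_env_trunc big1// => k _; rewrite indicE memNset ?mulr0. Qed.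

Lemma lower_env_itv m nu : 0 <= lower_env m nu <= F nu.
Proof.
have [[k nk]|nk] := pselect (exists k : grid d m -> nat, cell_counts k nu).
  by rewrite (lower_envE nk) counts_inf_ge0 counts_inf_le.
by rewrite /lower_env; case: pselect => // _; rewrite lexx; case/andP: (FC nu).
Qed.

Lemma lower_env_trunc_itv m K nu : 0 <= lower_env_trunc m K nu <= F nu.
Proof.
have [[k nk]|nk] := pselect (exists k : {ffun grid d m -> 'I_K},
    cell_counts (fun h => k h : nat) nu).
  by rewrite (lower_env_truncE nk) lower_env_itv.
rewrite lower_env_trunc_out; last by move=> k nk'; apply: nk; exists k.
by rewrite lexx; case/andP: (FC nu).
Qed.

Lemma cvg_lower_env_trunc m nu : lower_env_trunc m K nu @[K --> \oo] --> lower_env m nu.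
Proof.
have [[k nk]|nk] := pselect (exists k : grid d m -> nat, cell_counts k nu).
  apply: cvg_near_cst; exists (\max_h k h).+1 => // K /= maxK.
  have kK h : (k h < K)%N by apply: leq_trans maxK; rewrite ltnS leq_bigmax.
  apply: (@lower_env_truncE _ _ [ffun h => Ordinal (kK h)]).
  by move=> h; rewrite ffunE nk.
apply: cvg_near_cst; apply: nearW => K; rewrite lower_env_trunc_out.
  by rewrite /lower_env; case: pselect.
by move=> k nk'; apply: nk; exists (fun h => k h : nat).
Qed.

Lemma measurable_lower_env_trunc m K :
  measurable_fun setT (lower_env_trunc m K : borel (lfmeasure R d) -> R).
Proof.
apply: measurable_sum => k; apply: measurable_funM => //.
by apply: measurable_indic; exact: measurable_cell_counts.
Qed.

Lemma measurable_lower_env m :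
  measurable_fun setT (lower_env m : borel (lfmeasure R d) -> R).
Proof.
apply: (@measurable_fun_cvg _ (borel (lfmeasure R d)) R setT (lower_env_trunc m)).
  exact: measurable_lower_env_trunc.
by move=> nu _; exact: cvg_lower_env_trunc.
Qed.

(** For m large F is at least F nu - e on all measures with the same cell
    masses as nu, hence so is its infimum over them. *)
Lemma cvg_lower_env nu : (forall m, exists k : grid d m -> nat, cell_counts k nu) ->
  lower_env m nu @[m --> \oo] --> F nu.
Proof.
move=> nuN; apply/cvgrPdist_le => e e0.
have := vague_continuous_same_cells nu cF e0.
apply: filterS => m H; have [k nk] := nuN m.
have /andP[_ leF] := lower_env_itv m nu.
rewrite ger0_norm ?subr_ge0// lerBlDl -lerBlDr (lower_envE nk).
apply: lb_le_inf; first by exists (F nu), nu.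
by move=> _ [nu' nk' <-]; apply/ltW/H; exact/(cell_counts_same nu' nk).
Qed.

End cell_counts.

Section criterion.
Context (R : realType) (d : nat).
Context (dT : nat -> measure_display) (T : forall n, measurableType (dT n)).
Context (P : forall n, probability (T n) R).
Context (Y : forall n, {mfun T n >-> borel (lfmeasure R d)}).
Context (dO : measure_display) (O : measurableType dO) (Q : probability O R).
Context (N : {mfun O >-> borel (lfmeasure R d)}).
Hypothesis cvg_counts : forall m (k : grid d m -> nat),
  P n [set w | cell_counts k (Y n w)] @[n --> \oo] --> Q [set w | cell_counts k (N w)].
Hypothesis N_counts : {ae Q, forall w, forall m,
  exists k : grid d m -> nat, cell_counts k (N w)}.

Lemma bounded_rv_comp d' (U : measurableType d') (Z : {mfun U >-> borel (lfmeasure R d)})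
    (G : lfmeasure R d -> R) :
  measurable_fun setT (G : borel (lfmeasure R d) -> R) ->
  (exists C, forall nu, `|G nu| <= C) -> bounded_rv (fun w => G (Z w)).
Proof.
move=> mG [C GC]; split; last by exists C.
exact: (measurableT_comp mG).
Qed.

Lemma measurable_counts_event d' (U : measurableType d')
    (Z : {mfun U >-> borel (lfmeasure R d)}) m (k : grid d m -> nat) :
  measurable [set w | cell_counts k (Z w)].
Proof.
rewrite -[X in measurable X]setTI; apply: (measurable_funP Z) => //.
exact: measurable_cell_counts.
Qed.

Lemma mean_lower_env_trunc d' (U : measurableType d') (S : probability U R)
    (Z : {mfun U >-> borel (lfmeasure R d)}) F m K :
  mean S (fun w => lower_env_trunc F m K (Z w)) =
  \sum_(k : {ffun grid d m -> 'I_K}) counts_inf F (fun h => k h : nat) *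
    fine (S [set w | cell_counts (fun h => k h : nat) (Z w)]).
Proof.
have bI (k : grid d m -> nat) : bounded_rv (fun w => \1_(cell_counts k) (Z w) : R).
  apply: (@bounded_rv_comp _ _ _ \1_(cell_counts k)).
    by apply: measurable_indic; exact: measurable_cell_counts.
  by exists 1 => nu; rewrite indicE; case: (_ \in _); rewrite ?normr1 ?normr0.
have mI (k : grid d m -> nat) :
    mean S (fun w => \1_(cell_counts k) (Z w)) = fine (S [set w | cell_counts k (Z w)]).
  rewrite /mean /Rintegral -[RHS]/(fine (S (Z @^-1` cell_counts k))).
  rewrite -[X in S X]setIT -integral_indic//.
  exact: measurable_counts_event.
rewrite /lower_env_trunc; elim: (index_enum _) => [|k s IH].
  by under [X in mean _ X]eq_fun do rewrite big_nil; rewrite big_nil (mean_cst S 0).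
under [X in mean _ X]eq_fun do rewrite big_cons.
rewrite big_cons meanD; last 2 first.
- exact: bounded_rvZ.
- by apply: bounded_rv_sum => k'; exact: bounded_rvZ.
by rewrite IH meanZ// mI.
Qed.

(** Choose m with E lower_env(N) close to E F(N), then K with the truncation
    close to lower_env; the mean of the truncation under Y n converges, and F
    is above it. *)
Lemma near_mean_lower_bound (F : lfmeasure R d -> R) (C : R) : continuous F ->
  (forall nu, 0 <= F nu <= C) -> forall e, 0 < e ->
  \forall n \near \oo,
    mean Q (fun w => F (N w)) - e <= mean (P n) (fun w => F (Y n w)).
Proof.
move=> cF FC e e0.
have e3 : 0 < e / 3 by rewrite divr_gt0.
have mF : measurable_fun setT (F : borel (lfmeasure R d) -> R).
  exact: continuous_measurable_borel.
have bound (G : lfmeasure R d -> R) : (forall nu, 0 <= G nu <= F nu) ->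
    forall nu, `|G nu| <= C.
  move=> GF nu; have /andP[G0 GFn] := GF nu; rewrite ger0_norm//.
  by apply: le_trans GFn _; case/andP: (FC nu).
have Ftrunc m K := lower_env_trunc_itv FC m K.
have Flim m := lower_env_itv FC m.
have cvg1 : mean Q (fun w => lower_env F m (N w)) @[m --> \oo] --> mean Q (fun w => F (N w)).
  apply: (@cvg_mean_bounded _ _ _ _ _ _ C).
  - by move=> m; apply: (measurableT_comp (measurable_lower_env F m)).
  - exact: (measurableT_comp mF).
  - by move=> m w; apply: bound.
  - by apply: filterS N_counts => w Nw; exact: cvg_lower_env.
have cvg2 m : mean Q (fun w => lower_env_trunc F m K (N w)) @[K --> \oo] -->
    mean Q (fun w => lower_env F m (N w)).
  apply: (@cvg_mean_bounded _ _ _ _ _ _ C).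
  - by move=> K; apply: (measurableT_comp (measurable_lower_env_trunc F m K)).
  - exact: (measurableT_comp (measurable_lower_env F m)).
  - by move=> K w; apply: bound.
  - by apply: aeW => w; exact: cvg_lower_env_trunc.
have cvg3 m K : mean (P n) (fun w => lower_env_trunc F m K (Y n w)) @[n --> \oo] -->
    mean Q (fun w => lower_env_trunc F m K (N w)).
  under eq_fun do rewrite mean_lower_env_trunc.
  rewrite mean_lower_env_trunc.
  apply: cvg_sum_seq => k.
  apply: cvgM; [exact: cvg_cst|apply: fine_cvg].
  rewrite fineK; first exact: cvg_counts.
  by apply: fin_num_measure; exact: measurable_counts_event.
have [m _ /(_ m (leqnn m)) Hm] : \forall m \near \oo,
    mean Q (fun w => F (N w)) - e / 3 < mean Q (fun w => lower_env F m (N w)).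
  by apply: (cvgr_gt _ cvg1); rewrite ltrBlDr ltrDl.
have [K _ /(_ K (leqnn K)) HK] : \forall K \near \oo,
    mean Q (fun w => lower_env F m (N w)) - e / 3 < mean Q (fun w => lower_env_trunc F m K (N w)).
  by apply: (cvgr_gt _ (cvg2 m)); rewrite ltrBlDr ltrDl.
have : \forall n \near \oo, mean Q (fun w => lower_env_trunc F m K (N w)) - e / 3 <
    mean (P n) (fun w => lower_env_trunc F m K (Y n w)).
  by apply: (cvgr_gt _ (cvg3 m K)); rewrite ltrBlDr ltrDl.
apply: filterS => n Hn.
have : mean (P n) (fun w => lower_env_trunc F m K (Y n w)) <= mean (P n) (fun w => F (Y n w)).
  apply: mean_le => [||w]; last by case/andP: (Ftrunc m K (Y n w)).
    apply: bounded_rv_comp; first exact: measurable_lower_env_trunc.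
    by exists C; apply: bound.
  by apply: bounded_rv_comp => //; exists C; apply: bound => nu; rewrite lexx andbT; case/andP: (FC nu).
move: HK Hm Hn.
rewrite /=; move: (mean _ _) (mean _ _) (mean _ _) (mean _ _) (mean _ _) => a b c f g; lra.
Qed.

(** The lower bound for F + C >= 0 and for C - F >= 0 gives both sides. *)
Lemma weak_cvg_of_cell_counts :
  weak_cvg (fun n => distribution (P n) (Y n)) (distribution Q N).
Proof.
move=> F cF [C FC].
have mF : measurable_fun setT (F : borel (lfmeasure R d) -> R).
  exact: continuous_measurable_borel.
have bF d' (U : measurableType d') (Z : {mfun U >-> borel (lfmeasure R d)}) :
    bounded_rv (fun w => F (Z w)).
  by apply: bounded_rv_comp => //; exists C.
have lawE d' (U : measurableType d') (S : probability U R)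
    (Z : {mfun U >-> borel (lfmeasure R d)}) :
    (\int[distribution S Z]_x (F x)%:E = (mean S (fun w => F (Z w)))%:E)%E.
  have intF := bounded_rv_integrable S (bF _ _ Z).
  rewrite integral_distribution//; last exact/measurable_EFinP.
  by rewrite /mean /Rintegral fineK//; exact: integrable_fin_num.
rewrite lawE; under eq_fun do rewrite lawE.
apply: cvg_EFin; first exact: nearW.
apply/cvgrPdist_le => e e0.
have bound nu : - C <= F nu <= C by rewrite -ler_norml.
have c1 : continuous (fun nu => F nu + C).
  move=> nu; apply: (cvg_comp _ _ (cF nu) (_ : z + C @[z --> F nu] --> F nu + C)).
  by apply: cvgD; [exact: cvg_id|exact: cvg_cst].
have c2 : continuous (fun nu => C - F nu).
  move=> nu; apply: (cvg_comp _ _ (cF nu) (_ : C - z @[z --> F nu] --> C - F nu)).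
  by apply: cvgB; [exact: cvg_cst|exact: cvg_id].
have b1 nu : 0 <= F nu + C <= C + C by have := bound nu; lra.
have b2 nu : 0 <= C - F nu <= C + C by have := bound nu; lra.
have m1 d' (U : measurableType d') (S : probability U R)
    (Z : {mfun U >-> borel (lfmeasure R d)}) :
    mean S (fun w => F (Z w) + C) = mean S (fun w => F (Z w)) + C.
  by rewrite (meanD S (bF _ _ Z) (bounded_rv_cst _ C)) mean_cst.
have m2 d' (U : measurableType d') (S : probability U R)
    (Z : {mfun U >-> borel (lfmeasure R d)}) :
    mean S (fun w => C - F (Z w)) = C - mean S (fun w => F (Z w)).
  have -> : (fun w => C - F (Z w)) = cst C \+ (fun w => -1 * F (Z w)).
    by apply/funext => w /=; rewrite mulN1r.
  rewrite meanD ?meanZ ?mean_cst ?mulN1r//; first exact: bounded_rv_cst.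
  exact: bounded_rvZ.
have := near_mean_lower_bound c1 b1 e0; have := near_mean_lower_bound c2 b2 e0.
apply: filterS2 => n; rewrite !m1 !m2 /= ler_norml => *; lra.
Qed.

End criterion.

(** * Cell counts of the lattice field *)

Section block_lists.
Context (B : finType) (I : choiceType) (sites : B -> seq I).

Definition block_list : seq (B * I) := [seq (b, j) | b <- enum B, j <- sites b].

Lemma block_count_list (x : I -> bool) b :
  block_count block_list x b = count x (sites b).
Proof.
rewrite /block_count /block_list count_flatten -map_comp sumnE big_map big_enum/=.
rewrite (bigD1 b)//= count_map big1 ?addn0 => [|b' bb']; last first.
  by rewrite count_map -[RHS](count_pred0 (sites b')); apply: eq_count => j /=;
    rewrite (negbTE bb').
by apply: eq_count => j /=; rewrite eqxx.
Qed.

Lemma count_block_list b :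
  count (fun q => q.1 == b) block_list = size (sites b).
Proof.
rewrite -(count_predT (sites b)) -block_count_list /block_count.
by apply: eq_count => q /=; rewrite andbT.
Qed.

Lemma size_block_list : size block_list = (\sum_b size (sites b))%N.
Proof. by rewrite size_allpairs_dep sumnE big_map big_enum. Qed.

Lemma block_list_uniq : (forall b, uniq (sites b)) ->
  (forall b b' j, j \in sites b -> j \in sites b' -> b = b') ->
  uniq (unzip2 block_list).
Proof.
move=> us ds; rewrite /unzip2 map_allpairs; apply: allpairs_uniq_dep => //.
  exact: enum_uniq.
move=> _ _ /allpairsPdep[b [j [_ jb ->]]] /allpairsPdep[b' [j' [_ jb' ->]]] /= jj'.
by rewrite -jj' in jb' *; rewrite (ds _ _ _ jb jb').
Qed.

End block_lists.

Definition cell_sites (R : realType) (d n m : nat) (h : grid d m) :=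
  box_sites n (grid_lo R h) (grid_hi R h).

Section lattice_field.
Context (d : nat) (dT : measure_display) (T : measurableType dT) (R : realType).
Context (P : probability T R) (n : nat) (X : 'rV[int]_d -> {RV P >-> R}).
Hypothesis X01 : forall j w, X j w = 0 \/ X j w = 1.
Hypothesis X_assoc : associated_family P X.
Hypothesis X_stat : weakly_stationary P X.

Lemma mean_bool (b : T -> bool) : measurable_fun setT b ->
  mean P (fun w => (b w)%:R) = fine (P [set w | b w]).
Proof.
move=> mb; rewrite /mean /Rintegral -[X in P X]setIT -integral_indic//.
  by congr fine; apply: eq_integral => w _; rewrite indicE mem_setE.
rewrite (_ : [set w | b w] = b @^-1` [set true]); last by apply/seteqP; split.
by rewrite -[X in measurable X]setTI; exact: mb.
Qed.

Lemma mean_stationary p : P [set w | X 0 w = 1] = p%:E ->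
  (forall j, mean P (X j) = p) /\ 0 <= p <= 1.
Proof.
move=> Pp; have mean0 : mean P (X 0) = p.
  rewrite (_ : (X 0 : T -> R) = fun w => (ones X w 0)%:R); last first.
    by apply/funext => w; exact: onesE.
  rewrite mean_bool; last exact: measurable_ones.
  rewrite (_ : [set w | _] = [set w | X 0 w = 1]) ?Pp//.
  by apply/seteqP; split => w /eqP.
split=> [j|]; last first.
  have mX : measurable (X 0 @^-1` [set 1]) by exact: measurable_funPTI.
  by rewrite -!lee_fin -Pp measure_ge0 probability_le1.
apply: EFin_inj; rewrite -mean0 -!expectation_mean; last 2 first.
- exact: bounded_rv01.
- exact: bounded_rv01.
by case: X_stat => + _; apply.
Qed.

(** By stationarity cov(X_i, X_j) = cov(X_0, X_(i-j)), and the differences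
    i - j are distinct and nonzero, so the sum is a partial sum of sigma. *)
Lemma stationary_cov_sum_le sigma (j : 'rV[int]_d) (s : seq 'rV[int]_d) :
  (\esum_(i in [set i | i != 0%R]) covariance P (X 0%R) (X i))%E = sigma%:E ->
  uniq (j :: s) -> \sum_(i <- s) rcov P (X i) (X j) <= sigma.
Proof.
move=> sE /= /andP[js us]; rewrite -lee_fin -sE -sumEFin.
rewrite (eq_bigr (fun i => covariance P (X 0) (X (i - j)))) => [|i _]; last first.
  rewrite -covariance_rcov; [|exact: bounded_rv01|exact: bounded_rv01].
  by rewrite covarianceC; case: X_stat => _; apply; rewrite subr0.
rewrite -(big_map (fun i => i - j) xpredT (fun i => covariance P (X 0) (X i))).
have us' : uniq [seq i - j | i <- s] by rewrite map_inj_uniq//; exact: addIr.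
apply: esum_ge; exists [set` [seq i - j | i <- s]]; last by rewrite -fsbig_seq.
split; first exact: finite_seq.
move=> _ /mapP[i is_ ->] /=; rewrite subr_eq0.
by apply: contraNN js => /eqP <-.
Qed.

Lemma scaled_measure_box w (a b : 'I_d -> R) : (forall i, a i <= b i) ->
  scaled_measure n X01 w (box a b) = (count (ones X w) (box_sites n a b))%:R%:E.
Proof.
move=> ab; rewrite /scaled_measure /= /lattice_measure.
have -> : lattice_points n (box a b) = [set` box_sites n a b].
  by apply/seteqP; split => j /=; rewrite mem_box_sites.
rewrite esum_fset; [|exact: finite_seq|]; last first.
  by move=> j _; rewrite lee_fin (onesE X01).
rewrite -fsbig_seq; last exact: box_sites_uniq.
rewrite sumEFin; congr (_ %:E); rewrite -sum1_count natr_sum [in RHS]big_mkcond/=.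
by apply: eq_bigr => j _; rewrite (onesE X01); case: ifP.
Qed.

(** The cells are the blocks and their lattice points the sites, all of them
    distinct because the cells are disjoint. *)
Lemma cell_counts_approx m (k : grid d m -> nat) p sigma :
  P [set w | X 0 w = 1] = p%:E ->
  (\esum_(i in [set i | i != 0%R]) covariance P (X 0%R) (X i))%E = sigma%:E ->
  `|fine (P [set w | cell_counts k (scaled_measure n X01 w)]) -
    \prod_(h : grid d m) binomial_weight p (size (cell_sites R n h)) (k h)| <=
  2 * sigma *+ (\sum_(h : grid d m) size (cell_sites R n h))%N.
Proof.
move=> pE sigmaE; pose sites (h : grid d m) := cell_sites R n h.
have [meanX p01] := mean_stationary pE.
have lohi (h : grid d m) i : grid_lo R h i <= grid_hi R h i by exact/ltW/grid_lo_lt.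
have uniq_sites : uniq (unzip2 (block_list sites)).
  apply: block_list_uniq => [h|h h' j]; first exact: box_sites_uniq.
  rewrite !mem_box_sites// !lattice_pointsE; exact: cell_inj.
have := @counts_are_approx _ _ _ _ _ _ X01 X_assoc _ _ _ p01 meanX
  (fun j s => stationary_cov_sum_le sigmaE) (block_list sites) k uniq_sites.
rewrite size_block_list; under eq_bigr do rewrite count_block_list.
rewrite mean_bool; last exact: measurable_counts_are.
rewrite (_ : [set w | counts_are _ _ _] =
  [set w | cell_counts k (scaled_measure n X01 w)])//.
apply/seteqP; split => w /=.
  move=> /forallP H h; rewrite scaled_measure_box//.
  by have := H h; rewrite block_count_list => /eqP ->.
move=> H; apply/forallP => h; have := H h.
rewrite block_count_list scaled_measure_box// => -[] /eqP.
by rewrite eqr_nat.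
Qed.

End lattice_field.

Section field_limit.
Context (R : realType) (d : nat) (lambda : R).
Context (dT : nat -> measure_display) (T : forall n, measurableType (dT n)).
Context (P : forall n, probability (T n) R).
Context (X : forall n, 'rV[int]_d -> {RV (P n) >-> R}).
Hypothesis X01 : forall n j w, X n j w = 0 \/ X n j w = 1.
Hypothesis X_assoc : forall n, associated_family (P n) (X n).
Hypothesis X_stat : forall n, weakly_stationary (P n) (X n).
Hypothesis p_asymp : exists2 e : nat -> R, e n @[n --> \oo] --> 0 &
       forall n, P n [set w | X n 0 w = 1] =
                 ((lambda + e n) / n.+1%:R ^+ d)%:E.
Hypothesis sigma_lim : ((n.+1%:R ^+ d)%:E *
         \esum_(j in [set j | j != 0%R]) covariance (P n) (X n 0%R) (X n j))%E
       @[n --> \oo] --> 0%E.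
Hypothesis d_gt0 : (0 < d)%N.

Definition poisson_weight (l : R) (k : nat) : R := l ^+ k / k`!%:R * expR (- l).

(** The volume is kept as a product over the sides, the form in which
    [lebesgue_rV_box] gives it. *)
Definition cell_mass m : R := lambda * \prod_(i < d) m.+1%:R^-1.

(** The number of sites is of order n^d, so the distance to the product of
    binomial weights is of order n^d sigma(n) and tends to 0; the binomial
    weights tend to Poisson weights. *)
Lemma cvg_cell_counts m (k : grid d m -> nat) :
  P n [set w | cell_counts k (scaled_measure n (@X01 n) w)] @[n --> \oo] -->
  (\prod_h poisson_weight (cell_mass m) (k h))%:E.
Proof.
have [e e0 pE] := p_asymp.
pose p n := (lambda + e n) / n.+1%:R ^+ d.
pose V n : R := n.+1%:R ^+ d.
have V0 n : 0 < V n by rewrite exprn_gt0.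
pose sites n (h : grid d m) := cell_sites R n h.
have p0 n : 0 <= p n.
  by have [_ /andP[]] := mean_stationary (@X01 n) (@X_stat n) (pE n).
have cvg_num : lambda + e n @[n --> \oo] --> lambda.
  by rewrite -[X in _ --> X]addr0; apply: cvgD => //; exact: cvg_cst.
have cvgV : (V n)^-1 @[n --> \oo] --> 0.
  apply: (squeeze_cvgr (f := fun=> 0) (h := fun n => n.+1%:R^-1)).
  - apply: nearW => n; rewrite invr_ge0 (ltW (V0 n))/= lef_pV2 ?posrE//.
    by rewrite /V -{1}[n.+1%:R]expr1 ler_weXn2l// ler1n.
  - exact: cvg_cst.
  - exact: cvg_harmonic.
have pcvg : p n @[n --> \oo] --> 0.
  by rewrite -[X in _ --> X](mulr0 lambda); apply: cvgM.
have sizecvg h : (size (sites n h))%:R / V n @[n --> \oo] --> (\prod_(i < d) m.+1%:R^-1 : R).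
  have := @cvg_size_box_sites R d (grid_lo R h) (grid_hi R h)
    (fun i => ltW (grid_lo_lt R h i)).
  rewrite (eq_bigr (fun=> m.+1%:R^-1))// => i _.
  by rewrite grid_hiE addrC addKr.
have Npcvg h : (size (sites n h))%:R * p n @[n --> \oo] --> cell_mass m.
  rewrite (_ : (fun n => _) = fun n => (lambda + e n) * ((size (sites n h))%:R / V n)).
    exact: cvgM.
  by apply/funext => n; rewrite /p -/(V n); ring.
have prodcvg : \prod_h binomial_weight (p n) (size (sites n h)) (k h) @[n --> \oo] -->
    \prod_h poisson_weight (cell_mass m) (k h).
  by apply: cvg_prod_seq => h; exact: cvg_binomial_weight.
move: sigma_lim => /fine_cvgP[sigma_fin sigma_cvg].
pose sigma n := fine (\esum_(j in [set j | j != 0%R]) covariance (P n) (X n 0%R) (X n j))%E.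
have Ppre n : (P n [set w | cell_counts k (scaled_measure n (@X01 n) w)]) \is a fin_num.
  apply: fin_num_measure; rewrite -[X in measurable X]setTI.
  apply: (measurable_funP (scaled_measure n (@X01 n))) => //.
  exact: measurable_cell_counts.
apply/fine_cvgP; split; first exact: nearW.
(* Number of sites times sigma, written as (sites / V) * (V sigma). *)
have errcvg : 2 * fine ((V n)%:E * \esum_(j in [set j | j != 0%R])
     covariance (P n) (X n 0%R) (X n j))%E * (\sum_h (size (sites n h))%:R / V n)
     @[n --> \oo] --> 0.
  rewrite -[X in _ --> X](mul0r (\sum_(h : grid d m) \prod_(i < d) m.+1%:R^-1 : R)).
  apply: cvgM; last exact: cvg_sum_seq.
  by rewrite -[X in _ --> X](mulr0 2); apply: cvgM; [exact: cvg_cst|exact: sigma_cvg].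
apply/cvgrPdist_le => eps eps0.
have eps2 : 0 < eps / 2 by rewrite divr_gt0.
have /cvgrPdist_le/(_ _ eps2) := prodcvg.
have /cvgrPdist_le/(_ _ eps2) := errcvg.
move: sigma_fin; apply: filterS3 => n finn errn prodn.
have esumE : (\esum_(j in [set j | j != 0%R]) covariance (P n) (X n 0%R) (X n j))%E =
    (sigma n)%:E.
  rewrite /sigma; move: finn; case: (\esum_(_ in _) _)%E => [r|/=|/=]//.
    by rewrite gt0_muley// lte_fin.
  by rewrite gt0_muleNy// lte_fin.
have := @cell_counts_approx d _ _ R (P n) n (X n) (@X01 n) (@X_assoc n) (@X_stat n)
  m k (p n) (sigma n) (pE n) esumE.
rewrite -/(sites n) => approx.
have errE : 2 * sigma n *+ (\sum_h size (sites n h))%N <= eps / 2.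
  move: errn; rewrite sub0r normrN esumE /= => /(le_trans (ler_norm _)).
  apply: le_trans; rewrite -mulr_natr natr_sum -mulr_suml.
  by rewrite le_eqVlt; apply/orP; left; apply/eqP; field; rewrite gt_eqF.
move: prodn approx errE; rewrite distrC /=.
set a := fine _; set b := \prod_h _; set c := \prod_h _; set f := _ *+ _ => H1 H2 H3.
rewrite distrC -(subrKA b) (splitr eps).
apply: le_trans (ler_normD _ _) (lerD _ H1); exact: le_trans H2 H3.
Qed.

End field_limit.

(** * The Poisson measure, and the theorem *)

Section poisson_side.
Context (R : realType) (d : nat) (lambda : R) (lambda_gt0 : 0 < lambda).
Context (dO : measure_display) (O : measurableType dO) (Q : probability O R).
Context (mu : {mfun O >-> borel (lfmeasure R d)}).
Hypothesis mu_poisson : poisson_random_measure Q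
  (fun A => lambda%:E * lebesgue_rV A)%E mu.

Lemma cell_mass_gt0 m : 0 < cell_mass d lambda m.
Proof. by rewrite /cell_mass mulr_gt0// prodr_gt0// => i _; rewrite invr_gt0. Qed.

Lemma intensity_cell m (h : grid d m) :
  (lambda%:E * lebesgue_rV (cell h) = (cell_mass d lambda m)%:E)%E.
Proof.
rewrite /cell /box lebesgue_rV_box; last by move=> i; exact/ltW/grid_lo_lt.
rewrite -EFinM /cell_mass; congr (_ * _)%:E.
by apply: eq_bigr => i _; rewrite grid_hiE addrC addKr.
Qed.

Lemma poisson_cell m (h : grid d m) k :
  Q [set w | mu w (cell h) = k%:R%:E] = (poisson_weight (cell_mass d lambda m) k)%:E.
Proof.
have [+ _] := mu_poisson.
move=> /(_ (cell h) (measurable_cell h)); rewrite intensity_cell ltry.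
by move=> /(_ isT) /(_ k).
Qed.

Lemma poisson_cell_counts m (k : grid d m -> nat) :
  Q [set w | cell_counts k (mu w)] =
  (\prod_h poisson_weight (cell_mass d lambda m) (k h))%:E.
Proof.
pose A (i : 'I_#|grid d m|) : set (borel 'rV[R]_d) := cell (enum_val i).
have tA : trivIset setT A.
  move=> i j _ _ [x [xi xj]]; apply: enum_val_inj; exact: cell_inj xi xj.
have [_ /(_ _ A (fun i => measurable_cell (enum_val i)) tA)] := mu_poisson.
move=> /(_ (fun i => [set (k (enum_val i))%:R%:E])) indep.
rewrite (_ : [set w | _] = \bigcap_i
    ((fun w => mu w (A i)) @^-1` [set (k (enum_val i))%:R%:E])); last first.
  apply/seteqP; split => w H => [i _|h]; first exact: H.
  by have := H (enum_rank h) I; rewrite /A /= enum_rankK.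
rewrite indep; last by move=> i; exact: emeasurable_set1.
rewrite -(big_enum_val (fun h => Q [set w | mu w (cell h) = (k h)%:R%:E]))/=.
rewrite -prodEFin.
by apply: eq_bigr => h _; exact: poisson_cell.
Qed.

Lemma sum_poisson_weight (l : R) : 0 < l ->
  (\sum_(k <oo) (poisson_weight l k)%:E = 1)%E.
Proof.
move=> l0; have : poisson_prob l 0 [set: nat] = 1%E by exact: probability_setT.
rewrite /poisson_prob l0 -nneseries_esumT; last first.
  by move=> k; rewrite lee_fin poisson_pmf_ge0.
move=> <-; apply: eq_eseriesr => k _.
by rewrite /poisson_pmf l0.
Qed.

(** The events that the count of a cell is 0, 1, 2, ... are disjoint and their
    probabilities sum to 1. *)
Lemma poisson_cell_natural m (h : grid d m) :
  {ae Q, forall w, exists k : nat, mu w (cell h) = k%:R%:E}.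
Proof.
pose A k := [set w | mu w (cell h) = k%:R%:E].
have mA k : measurable (A k).
  rewrite -[X in measurable X]setTI.
  have mbox : measurable_fun setT ((fun nu => nu (cell h)) : borel (lfmeasure R d) -> \bar R).
    exact: measurable_lfm_box.
  have mcount := measurableT_comp mbox (measurable_funPT mu).
  exact: (mcount measurableT [set k%:R%:E] (emeasurable_set1 _)).
have tA : trivIset setT A.
  move=> i j _ _ [w [wi wj]]; move: wi; rewrite /A /= wj => -[] /eqP.
  by rewrite eqr_nat eq_sym => /eqP.
have QA : Q (\bigcup_k A k) = 1%E.
  rewrite measure_semi_bigcup//; last exact: bigcup_measurable.
  rewrite -[RHS](sum_poisson_weight (cell_mass_gt0 m)).
  by apply: eq_eseriesr => k _; exact: poisson_cell.
have mU : measurable (\bigcup_k A k) by exact: bigcup_measurable.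
exists (~` (\bigcup_k A k)); split; first exact: measurableC.
  by rewrite probability_setC// QA subee.
by move=> w /= H [k _ Ak]; apply: H; exists k.
Qed.

Lemma poisson_counts_natural : {ae Q, forall w, forall m,
  exists k : grid d m -> nat, cell_counts k (mu w)}.
Proof.
apply: ae_foralln => m.
have natural := filter_forall (ae_filter_ringOfSetsType Q)
  (fun h : grid d m => poisson_cell_natural h).
apply: filterS natural => w /(_ _)/cid H.
by exists (fun h => sval (H h)) => h; case: (H h).
Qed.

End poisson_side.

Theorem theorem1 (R : realType) (d : nat) (d_gt0 : (0 < d)%N)
    (lambda : R) (lambda_gt0 : 0 < lambda)
    (dT : nat -> measure_display)
    (T : forall n, measurableType (dT n))
    (P : forall n, probability (T n) R)
    (X : forall n, 'rV[int]_d -> {RV (P n) >-> R})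
    (X01 : forall n j w, X n j w = 0 \/ X n j w = 1)
    (X_assoc : forall n, associated_family (P n) (X n))
    (X_stat : forall n, weakly_stationary (P n) (X n))
    (p_asymp : exists2 e : nat -> R, e n @[n --> \oo] --> 0 &
       forall n, P n [set w | X n 0 w = 1] =
                 ((lambda + e n) / n.+1%:R ^+ d)%:E)
    (sigma_lim : ((n.+1%:R ^+ d)%:E *
         \esum_(j in [set j | j != 0%R]) covariance (P n) (X n 0%R) (X n j))%E
       @[n --> \oo] --> 0%E)
    (dO : measure_display) (O : measurableType dO) (Q : probability O R)
    (mu : {mfun O >-> borel (lfmeasure R d)})
    (mu_poisson : poisson_random_measure Q
       (fun A => lambda%:E * lebesgue_rV A)%E mu) :
  weak_cvg (fun n => distribution (P n) (scaled_measure n (X01 n)))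
    (distribution Q mu).
Proof.
apply: weak_cvg_of_cell_counts => [m k|].
  rewrite (poisson_cell_counts mu_poisson).
  exact: (cvg_cell_counts X01 X_assoc X_stat p_asymp sigma_lim d_gt0).
exact: (poisson_counts_natural lambda_gt0 mu_poisson).
Qed.
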